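(* Let $A\in\mathcal D$ with generic part $A_0$, and suppose that $A^2-1$ has closed range. Then $\mathcal D_{A_0}$ is a complemented $C^\infty$ submanifold of $\mathcal B(\mathcal H_0)\times\mathcal B(\mathcal H_0)$, and for any fixed $(P_0,Q_0)\in\mathcal D_{A_0}$ the map $$\pi_{(P_0,Q_0)}:\mathcal U_{\mathcal A_0}\to\mathcal D_{A_0},\qquad\pi_{(P_0,Q_0)}(U)=(UP_0U^*,UQ_0U^* ),$$ is a $C^\infty$ submersion.
   Context: Let $\mathcal H$ be a complex Hilbert space, $\mathcal P(\mathcal H)$ the set of orthogonal projections in $\mathcal H$, and $\mathcal D=\{P-Q: P,Q\in\mathcal P(\mathcal H)\}$. For $A\in\mathcal D$ put $\mathcal H_0=(N(A)\oplus N(A^2-1))^\perp$ ($N$ denotes nullspace); this subspace reduces $A$. Let $A_0=A|_{\mathcal H_0}\in\mathcal B(\mathcal H_0)$ (the generic part of $A$) and $\mathcal D_{A_0}=\{(P_0,Q_0)\in\mathcal P(\mathcal H_0)\times\mathcal P(\mathcal H_0): P_0-Q_0=A_0\}$. Let $\mathcal A_0=\{T\in\mathcal B(\mathcal H_0): TA_0=A_0T\}$ and let $\mathcal U_{\mathcal A_0}$ be its unitary group, a real Banach-Lie group in the norm topology whose Lie algebra is the space of anti-Hermitian elements of $\mathcal A_0$. Manifolds are real Banach manifolds; a complemented submanifold is one whose tangent spaces are closed complemented subspaces of the ambient (real) Banach space; its topology is the relative norm topology. A submersion is a smooth map whose differential at each point is surjective with complemented kernel. *)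

(* Defs.v *)
From HB Require Import structures.
From mathcomp Require Import all_boot all_order all_algebra.
From mathcomp Require Import all_classical all_reals all_analysis.
From mathcomp Require Import complex.

Set Implicit Arguments.
Unset Strict Implicit.
Unset Printing Implicit Defensive.

Import Order.TTheory GRing.Theory Num.Theory.
Import numFieldNormedType.Exports.

Local Open Scope classical_set_scope.
Local Open Scope ring_scope.
Local Open Scope complex_scope.

Definition closed_linear (K : numFieldType) (V : normedModType K) (S : set V) :=
  [/\ S 0, forall (a : K) u v, S u -> S v -> S (a *: u + v) & closed S].

Record csubspace (K : numFieldType) (V : normedModType K) := CSubspace {
  csub_set :> set V;
  csub_closed_linear : closed_linear csub_set }.

Section CSubType.
Context {K : numFieldType} {V : normedModType K} (S : csubspace V).

Definition csub_pred : {pred V} := fun x => `[< csub_set S x >].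

Record csub := CSub { csub_val : V; csub_valP : csub_val \in csub_pred }.

Lemma csub_in (x : csub) : csub_set S (csub_val x).
Proof. by case: x => x /= /asboolP. Qed.

Lemma csub_submod_closed : submod_closed csub_pred.
Proof.
have [S0 SL _] := csub_closed_linear S; split; first exact/asboolP.
by move=> a u v /asboolP Su /asboolP Sv; apply/asboolP; exact: SL.
Qed.

HB.instance Definition _ :=
  GRing.isSubmodClosed.Build K V csub_pred csub_submod_closed.
HB.instance Definition _ := [isSub for csub_val].
HB.instance Definition _ := [Choice of csub by <:].
HB.instance Definition _ := [SubChoice_isSubLmodule of csub by <:].

Definition csub_norm (x : csub) : K := `|csub_val x|.

Lemma csub_normD x y : csub_norm (x + y) <= csub_norm x + csub_norm y.
Proof. exact: ler_normD. Qed.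

Lemma csub_normZ (l : K) x : csub_norm (l *: x) = `|l| * csub_norm x.
Proof. exact: normrZ. Qed.

Lemma csub_norm0_eq0 x : csub_norm x = 0 -> x = 0.
Proof. by move=> /normr0_eq0 x0; apply: val_inj; rewrite /= x0. Qed.

HB.instance Definition _ :=
  Lmodule_isNormed.Build K csub csub_normD csub_normZ csub_norm0_eq0.

End CSubType.

Section CSubComplete.
Context {K : numFieldType} {V : completeNormedModType K} (S : csubspace V).

Lemma csub_complete (F : set_system (csub S)) :
  ProperFilter F -> cauchy F -> cvg F.
Proof.
move=> FF /cauchy_ballP Fc.
have Gc : cauchy (@csub_val _ _ S @ F).
  apply/cauchy_ballP => e e0.
  have [[A B] /= [FA FB] AB] := Fc _ e0.
  exists ((@csub_val _ _ S) @` A, (@csub_val _ _ S) @` B).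
    by split => /=; [apply: filterS FA|apply: filterS FB] => x Ax; exists x.
  move=> [_ _] /= [[x Ax <-] [y By <-]].
  by have := AB (x, y) (conj Ax By); rewrite -!ball_normE.
have /cvg_ex[/= l Fl] : cvg (@csub_val _ _ S @ F) by exact: cauchy_cvg.
have Sl : csub_set S l.
  have [_ _ Scl] := csub_closed_linear S.
  apply: (@closed_cvg _ _ F _ (@csub_val _ _ S) _ Scl _ _ Fl) => //.
  by apply: nearW => x; exact: csub_in.
apply/cvg_ex; exists (CSub (introT (asboolP _) Sl)).
apply/cvgrPdist_lt => e e0; move/cvgrPdist_lt : Fl => /(_ e e0).
exact: filterS.
Qed.

HB.instance Definition _ := Uniform_isComplete.Build (csub S) csub_complete.

End CSubComplete.

HB.mixin Record CompleteNormedModule_isHilbert (R : realType) (H : Type)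
    & CompleteNormedModule R[i] H := {
  inner : H -> H -> R[i];
  inner_linear : forall y, linear_for *%R (inner ^~ y);
  inner_conj : forall x y, inner x y = Num.conj (inner y x);
  inner_norm : forall x, inner x x = `|x| ^+ 2
}.

#[short(type="hilbertType")]
HB.structure Definition Hilbert (R : realType) :=
  {H of CompleteNormedModule R[i] H & CompleteNormedModule_isHilbert R H}.

Section HilbertTheory.
Context {R : realType} {H : hilbertType R}.
Implicit Types (x y z : H) (a : R[i]).

Lemma innerDl x y z : inner (x + y) z = inner x z + inner y z.
Proof. by have := inner_linear z 1 x y; rewrite /= scale1r mul1r. Qed.

Lemma inner0l y : inner 0 y = 0 :> R[i].
Proof. by apply: (addrI (inner 0 y)); rewrite -innerDl !addr0. Qed.

Lemma innerZl a x y : inner (a *: x) y = a * inner x y.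
Proof. by have := inner_linear y a x 0; rewrite /= inner0l !addr0. Qed.

Lemma innerDr x y z : inner x (y + z) = inner x y + inner x z.
Proof. by rewrite inner_conj innerDl rmorphD /= -!inner_conj. Qed.

Lemma innerZr a x y : inner x (a *: y) = Num.conj a * inner x y.
Proof. by rewrite inner_conj innerZl rmorphM /= -inner_conj. Qed.

Lemma inner0r x : inner x 0 = 0 :> R[i].
Proof. by rewrite inner_conj inner0l rmorph0. Qed.

Lemma innerBr x y z : inner x (y - z) = inner x y - inner x z.
Proof. by rewrite innerDr -scaleN1r innerZr rmorphN rmorph1 mulN1r. Qed.

Lemma innerBl x y z : inner (x - y) z = inner x z - inner y z.
Proof. by rewrite innerDl -scaleN1r innerZl mulN1r. Qed.

Lemma inner_cauchy_schwarz x y : `|inner x y| <= `|x| * `|y|.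
Proof.
have [->|y0] := eqVneq y 0; first by rewrite inner0r !normr0 mulr0.
have yy : 0 < inner y y by rewrite inner_norm exprn_gt0 // normr_gt0.
have yyc : Num.conj (inner y y) = inner y y by rewrite -inner_conj.
have : 0 <= inner y y * (inner y y * inner x x - `|inner x y| ^+ 2).
  rewrite normCK.
  have : 0 <= `|inner y y *: x - inner x y *: y| ^+ 2 by exact: exprn_ge0.
  rewrite -inner_norm !(innerBr, innerBl, innerZr, innerZl) yyc.
  rewrite (inner_conj y x).
  set c := Num.conj _; set u := inner x y; set v := inner y y.
  by rewrite [v * u]mulrC subrr mulr0 subr0.
rewrite pmulr_rge0 // subr_ge0 !inner_norm -exprMn.
by rewrite ler_pXn2r ?nnegrE ?mulr_ge0 // mulrC.
Qed.

Definition orthoc_set (X : set H) : set H :=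
  [set y | forall x, X x -> inner x y = 0].

Lemma orthoc_closed_linear X : closed_linear (orthoc_set X).
Proof.
split=> [x _|a u v Xu Xv x Xx|]; first exact: inner0r.
  by rewrite innerDr innerZr Xu // Xv // mulr0 addr0.
move=> y cy x Xx; apply/eqP; rewrite -normr_le0; apply/ler_addgt0Pl => e e0.
have d0 : 0 < e / (`|x| + 1) by rewrite divr_gt0 // ltr_wpDl.
have [z [Xz]] := cy _ (nbhsx_ballx y _ d0); rewrite -ball_normE /= => yz.
rewrite addr0 -[y](subrK z) innerDr Xz // addr0.
rewrite (le_trans (inner_cauchy_schwarz _ _)) //.
rewrite (@le_trans _ _ (`|x| * (e / (`|x| + 1)))) ?ler_wpM2l // ?ltW //.
by rewrite mulrCA gtr_pMr // ltr_pdivrMr ?ltr_wpDl // mul1r ltrDl.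
Qed.

Definition orthoc X : csubspace H := CSubspace (orthoc_closed_linear X).

End HilbertTheory.

Section CSubHilbert.
Context {R : realType} {H : hilbertType R} (S : csubspace H).

Definition csub_inner (x y : csub S) : R[i] :=
  inner (csub_val x) (csub_val y).

Lemma csub_inner_linear y : linear_for *%R (csub_inner ^~ y).
Proof. by move=> a u v; exact: inner_linear. Qed.

Lemma csub_inner_conj x y : csub_inner x y = Num.conj (csub_inner y x).
Proof. exact: inner_conj. Qed.

Lemma csub_inner_norm x : csub_inner x x = `|x| ^+ 2.
Proof. exact: inner_norm. Qed.

HB.instance Definition _ := CompleteNormedModule_isHilbert.Build R (csub S)
  csub_inner_linear csub_inner_conj csub_inner_norm.

End CSubHilbert.

(* Shared by the two operator spaces below: [tok] embeds the real scalars into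
   the scalar field [K], and [nV], [nW] are real-valued norms. *)
Section OpNorm.
Context {R : realType} {K : numFieldType} {V W : lmodType K}.
Variables (tok : R -> K) (nV : V -> R) (nW : W -> R).

Definition opnorm (f : V -> W) : R := sup [set nW (f x) | x in [set x | nV x <= 1]].

Definition op_bounded (f : V -> W) := exists M : R, forall x, nW (f x) <= M * nV x.

Hypothesis tok1 : tok 1 = 1.
Hypothesis tokM : forall r s, tok (r * s) = tok r * tok s.
Hypothesis nV0 : forall x, nV x = 0 -> x = 0.
Hypothesis nV_ge0 : forall x, 0 <= nV x.
Hypothesis nVZ : forall r x, nV (tok r *: x) = `|r| * nV x.
Hypothesis nW0 : forall x, nW x = 0 -> x = 0.
Hypothesis nW_ge0 : forall x, 0 <= nW x.
Hypothesis nWZ : forall r x, nW (tok r *: x) = `|r| * nW x.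
Hypothesis nWD : forall x y, nW (x + y) <= nW x + nW y.

Lemma op_bounded_ge0 f : op_bounded f ->
  exists2 M, 0 <= M & forall x, nW (f x) <= M * nV x.
Proof.
move=> [M fM]; exists `|M| => // x; apply: le_trans (fM x) _.
by rewrite ler_wpM2r // ler_norm.
Qed.

Let nV00 : nV 0 = 0.
Proof.
have := nVZ 0 0; rewrite normr0 mul0r => <-.
by rewrite scaler0.
Qed.

Lemma opnorm_has_sup f : op_bounded f ->
  has_sup [set nW (f x) | x in [set x | nV x <= 1]].
Proof.
move=> /op_bounded_ge0[M M0 fM]; split.
  by exists (nW (f 0)), 0 => //=; rewrite nV00 ler01.
exists M => _ [x /= x1 <-]; apply: le_trans (fM x) _.
by rewrite ler_piMr.
Qed.

Lemma opnorm_ub f x : op_bounded f -> nV x <= 1 -> nW (f x) <= opnorm f.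
Proof.
move=> fb x1; apply: sup_upper_bound; first exact: opnorm_has_sup.
by exists x.
Qed.

Lemma opnorm_le f (M : R) : (forall x, nV x <= 1 -> nW (f x) <= M) ->
  opnorm f <= M.
Proof.
move=> fM; apply: ge_sup; last by move=> _ [x /= x1 <-]; exact: fM.
by exists (nW (f 0)), 0 => //=; rewrite nV00 ler01.
Qed.

Lemma opnormP f x : op_bounded f -> linear f -> nW (f x) <= opnorm f * nV x.
Proof.
move=> fb fl; have f0 : f 0 = 0.
  by have := fl (-1) 0 0; rewrite scaleN1r oppr0 addr0 scaleN1r addNr.
have [x0|x0] := eqVneq (nV x) 0.
  have -> : nW (f x) = 0.
    rewrite (nV0 x0) f0; have := nWZ 0 0; rewrite normr0 mul0r => <-.
    by rewrite scaler0.
  by rewrite x0 mulr0.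
have xp : 0 < nV x by rewrite lt_neqAle eq_sym x0 nV_ge0.
have fZ a u : f (a *: u) = a *: f u by have := fl a u 0; rewrite f0 !addr0.
have := @opnorm_ub f (tok (nV x)^-1 *: x) fb.
rewrite fZ nVZ nWZ ger0_norm ?invr_ge0 // mulVf // => /(_ (lexx _)).
by rewrite mulrC ler_pdivrMr.
Qed.

Lemma opnormD f g : op_bounded f -> op_bounded g ->
  opnorm (fun x => f x + g x) <= opnorm f + opnorm g.
Proof.
move=> fb gb; apply: opnorm_le => x x1.
by apply: le_trans (nWD _ _) _; apply: lerD; exact: opnorm_ub.
Qed.

Lemma op_boundedZ r f : op_bounded f -> op_bounded (fun x => tok r *: f x).
Proof.
move=> [M fM]; exists (`|r| * M) => x.
by rewrite nWZ -mulrA ler_wpM2l.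
Qed.

Lemma op_boundedD f g : op_bounded f -> op_bounded g ->
  op_bounded (fun x => f x + g x).
Proof.
move=> [M fM] [N gN]; exists (M + N) => x; apply: le_trans (nWD _ _) _.
by rewrite mulrDl lerD.
Qed.

Lemma opnorm_ge0 f : op_bounded f -> 0 <= opnorm f.
Proof.
by move=> fb; apply: le_trans (nW_ge0 (f 0)) _; apply: opnorm_ub; rewrite ?nV00 ?ler01.
Qed.

Lemma opnormZ r f : op_bounded f ->
  opnorm (fun x => tok r *: f x) = `|r| * opnorm f.
Proof.
have le s g : op_bounded g -> opnorm (fun x => tok s *: g x) <= `|s| * opnorm g.
  by move=> gb; apply: opnorm_le => x x1; rewrite nWZ ler_wpM2l // opnorm_ub.
move=> fb; apply/eqP; rewrite eq_le le //=.
have [->|r0] := eqVneq r 0.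
  rewrite normr0 mul0r; exact/opnorm_ge0/op_boundedZ.
have := @le r^-1 (fun x => tok r *: f x) (op_boundedZ r fb).
rewrite normfV -ler_pdivrMl ?invr_gt0 ?normr_gt0 // invrK.
congr (_ * opnorm _ <= _); apply/funext => x.
by rewrite scalerA -tokM mulVf // tok1 scale1r.
Qed.

Lemma opnorm_eq0 f : op_bounded f -> linear f -> opnorm f = 0 ->
  forall x, f x = 0.
Proof.
move=> fb fl f0 x; apply: nW0; apply/eqP; rewrite eq_le nW_ge0 andbT.
by have := opnormP x fb fl; rewrite f0 mul0r.
Qed.

End OpNorm.

Section BoundedOp.
Context {R : realType}.

Definition rnorm (V : normedModType R[i]) (x : V) : R := complex.Re `|x|.

Lemma rnormE (V : normedModType R[i]) (x : V) : (rnorm x)%:C = `|x|.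
Proof. by rewrite /rnorm RRe_real // normr_real. Qed.

Lemma rnorm_ge0 (V : normedModType R[i]) (x : V) : 0 <= rnorm x.
Proof. by rewrite -ler0c rnormE. Qed.

Lemma rnorm_eq0 (V : normedModType R[i]) (x : V) : rnorm x = 0 -> x = 0.
Proof. by move=> x0; apply: normr0_eq0; rewrite -rnormE x0. Qed.

Lemma rnormD (V : normedModType R[i]) (x y : V) :
  rnorm (x + y) <= rnorm x + rnorm y.
Proof. by rewrite -lecR rmorphD /= !rnormE ler_normD. Qed.

Lemma norm_real_complex (r : R) : `|r%:C| = `|r|%:C :> R[i].
Proof. by rewrite normc_def /= expr0n /= addr0 sqrtr_sqr. Qed.

Lemma rnormZ (V : normedModType R[i]) (r : R) (x : V) :
  rnorm (r%:C *: x) = `|r| * rnorm x.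
Proof.
by apply: (@complexI R); rewrite rmorphM /= !rnormE normrZ norm_real_complex.
Qed.

Context {H : normedModType R[i]}.

(* Complex-linear operators, made below into a normed space over the real
   scalars only, which is what the manifold notions use. *)
Record bop := BOp {
  bop_fun :> H -> H;
  bop_linear : linear bop_fun;
  bop_bounded : op_bounded (@rnorm H) (@rnorm H) bop_fun }.

Lemma bopP (S T : bop) : (forall x, S x = T x) -> S = T.
Proof.
case: S T => [f fl fb] [g gl gb] /= /funext fg.
by move: fl fb gl gb; rewrite fg => *; congr BOp; exact: Prop_irrelevance.
Qed.

Lemma bop0 (T : bop) : T 0 = 0.
Proof.
by have := bop_linear T (-1) 0 0; rewrite scaleN1r oppr0 addr0 scaleN1r addNr.
Qed.

Lemma bopD (T : bop) x y : T (x + y) = T x + T y.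
Proof. by have := bop_linear T 1 x y; rewrite !scale1r. Qed.

Lemma bopZ (T : bop) (a : R[i]) x : T (a *: x) = a *: T x.
Proof. by have := bop_linear T a x 0; rewrite bop0 !addr0. Qed.

HB.instance Definition _ := gen_eqMixin bop.
HB.instance Definition _ := gen_choiceMixin bop.

Definition bop_zero : bop.
Proof.
exists (fun=> 0) => [a u v|]; first by rewrite scaler0 addr0.
by exists 0 => x; rewrite mul0r /rnorm normr0.
Defined.

Definition bop_add (S T : bop) : bop.
Proof.
exists (fun x => S x + T x) => [a u v|].
  by rewrite !bop_linear scalerDr addrACA.
exact: op_boundedD (@rnormD H) _ _ (bop_bounded S) (bop_bounded T).
Defined.

Definition bop_scale (r : R) (T : bop) : bop.
Proof.
exists (fun x => r%:C *: T x) => [a u v|].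
  by rewrite bop_linear scalerDr !scalerA mulrC.
exact: op_boundedZ (@rnormZ H) r _ (bop_bounded T).
Defined.

Definition bop_one : bop.
Proof.
by exists id => //; exists 1 => x; rewrite mul1r.
Defined.

Definition bop_mul (S T : bop) : bop.
Proof.
exists (fun x => S (T x)) => [a u v|]; first by rewrite !bop_linear.
have [M M0 SM] := op_bounded_ge0 (@rnorm_ge0 H) (bop_bounded S).
have [N TN] := bop_bounded T.
exists (M * N) => x; apply: le_trans (SM _) _.
by rewrite -mulrA ler_wpM2l.
Defined.

Definition bop_opp : bop -> bop := bop_scale (-1).

Lemma bop_addA : associative bop_add.
Proof. by move=> S T U; apply: bopP => x /=; rewrite addrA. Qed.

Lemma bop_addC : commutative bop_add.
Proof. by move=> S T; apply: bopP => x /=; rewrite addrC. Qed.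

Lemma bop_add0 : left_id bop_zero bop_add.
Proof. by move=> S; apply: bopP => x /=; rewrite add0r. Qed.

Lemma bop_addN : left_inverse bop_zero bop_opp bop_add.
Proof.
by move=> S; apply: bopP => x /=; rewrite rmorphN rmorph1 scaleN1r addNr.
Qed.

HB.instance Definition _ :=
  GRing.isZmodule.Build bop bop_addA bop_addC bop_add0 bop_addN.

Lemma bop_subE (S T : bop) x : (S - T) x = S x - T x.
Proof. by rewrite /= rmorphN rmorph1 scaleN1r. Qed.

Lemma bopB (T : bop) x y : T (x - y) = T x - T y.
Proof. by rewrite bopD -scaleN1r bopZ scaleN1r. Qed.

Lemma bop_mulA : associative bop_mul.
Proof. by move=> S T U; apply: bopP. Qed.

Lemma bop_mul1l : left_id bop_one bop_mul.
Proof. by move=> S; apply: bopP. Qed.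

Lemma bop_mul1r : right_id bop_one bop_mul.
Proof. by move=> S; apply: bopP. Qed.

Lemma bop_mulDl : left_distributive bop_mul +%R.
Proof. by move=> S T U; apply: bopP. Qed.

Lemma bop_mulDr : right_distributive bop_mul +%R.
Proof. by move=> S T U; apply: bopP => x /=; rewrite bopD. Qed.

HB.instance Definition _ := GRing.Zmodule_isPzRing.Build bop
  bop_mulA bop_mul1l bop_mul1r bop_mulDl bop_mulDr.

Lemma bop_scaleA (r s : R) (T : bop) :
  bop_scale r (bop_scale s T) = bop_scale (r * s) T.
Proof. by apply: bopP => x /=; rewrite scalerA rmorphM. Qed.

Lemma bop_scale1 : left_id 1 bop_scale.
Proof. by move=> T; apply: bopP => x /=; rewrite rmorph1 scale1r. Qed.

Lemma bop_scaleDr : right_distributive bop_scale +%R.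
Proof. by move=> r S T; apply: bopP => x /=; rewrite scalerDr. Qed.

Lemma bop_scaleDl (T : bop) : {morph bop_scale^~ T : r s / r + s}.
Proof. by move=> r s; apply: bopP => x /=; rewrite rmorphD scalerDl. Qed.

HB.instance Definition _ := GRing.Zmodule_isLmodule.Build R bop
  bop_scaleA bop_scale1 bop_scaleDr bop_scaleDl.

Definition bop_norm (T : bop) : R := opnorm (@rnorm H) (@rnorm H) T.

Lemma bop_normD S T : bop_norm (S + T) <= bop_norm S + bop_norm T.
Proof.
by apply: (opnormD (@rnorm_ge0 H) (@rnormZ H) (@rnormD H)); exact: bop_bounded.
Qed.

Lemma bop_normZ (r : R) T : bop_norm (r *: T) = `|r| * bop_norm T.
Proof.
apply: (@opnormZ _ _ _ _ (real_complex R)) => //.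
- exact: rmorphM.
- exact: rnorm_ge0.
- exact: rnormZ.
- exact: rnorm_ge0.
- exact: rnormZ.
- exact: bop_bounded.
Qed.

Lemma bop_norm0_eq0 T : bop_norm T = 0 -> T = 0.
Proof.
move=> T0; apply: bopP.
apply: (opnorm_eq0 (@rnorm_eq0 H) (@rnorm_ge0 H) (@rnormZ H)
  (@rnorm_eq0 H) (@rnorm_ge0 H) (@rnormZ H)) => //.
- exact: bop_bounded.
- exact: bop_linear.
Qed.

HB.instance Definition _ :=
  Lmodule_isNormed.Build R bop bop_normD bop_normZ bop_norm0_eq0.

Lemma bop_normP (T : bop) x : rnorm (T x) <= `|T| * rnorm x.
Proof.
apply: (opnormP (@rnorm_eq0 H) (@rnorm_ge0 H) (@rnormZ H) (@rnormZ H)); [exact: bop_bounded|exact: bop_linear].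
Qed.

Lemma commutant_closed_linear (A : bop) :
  closed_linear [set T : bop | T * A = A * T].
Proof.
split=> [|r S T /= SA TA|]; first by rewrite /= mul0r mulr0.
  rewrite mulrDl mulrDr TA; congr (_ + _); apply: bopP => x /=.
  by rewrite bopZ; congr (_ *: _); have /(congr1 (fun U => bop_fun U x)) := SA.
move=> T cT; apply: bopP => x; apply/eqP; rewrite -subr_eq0; apply/eqP.
apply: rnorm_eq0; apply/eqP; rewrite eq_le rnorm_ge0 andbT.
apply/ler_addgt0Pl => e e0; rewrite addr0.
pose c := 2 * `|A| * rnorm x + 1.
have c0 : 0 < c by rewrite ltr_wpDl // !mulr_ge0 // rnorm_ge0.
have d0 : 0 < e / c by rewrite divr_gt0.
have [S [SA]] := cT _ (nbhsx_ballx T _ d0); rewrite -ball_normE /= => TS.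
have -> : (T * A) x - (A * T) x = (T - S) (A x) + - A ((T - S) x).
  have : (S * A) x = (A * S) x by rewrite SA.
  rewrite !bop_subE bopB /= => ->.
  by rewrite opprB addrA subrK.
apply: le_trans (rnormD _ _) _.
have -> : rnorm (- A ((T - S) x)) = rnorm (A ((T - S) x)).
  by rewrite /rnorm normrN.
have B1 := bop_normP (T - S) (A x); have B2 := bop_normP A ((T - S) x).
have B3 := bop_normP A x; have B4 := bop_normP (T - S) x.
have n0 : 0 <= `|T - S| by [].
apply: (@le_trans _ _ (`|T - S| * c)); last first.
  by rewrite -ler_pdivlMr // ltW.
apply: (@le_trans _ _ (`|T - S| * (`|A| * rnorm x) + `|A| * (`|T - S| * rnorm x))).
  apply: lerD; first by apply: le_trans B1 _; rewrite ler_wpM2l.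
  by apply: le_trans B2 _; rewrite ler_wpM2l.
rewrite [`|A| * (_ * _)]mulrCA -mulrDr ler_wpM2l // /c -mulrA mulr_natl mulr2n.
by rewrite lerDl.
Qed.

(* The algebra of operators commuting with [A], as a real Banach space. *)
Definition commutant (A : bop) : csubspace bop :=
  CSubspace (commutant_closed_linear A).

End BoundedOp.
Arguments bop {R} H.

Section ContinuousLinear.
Context {R : realType} {E F : normedModType R}.
Let nE : E -> R := fun x => `|x|.
Let nF : F -> R := fun x => `|x|.

Record clin := CLin {
  clin_fun :> E -> F;
  clin_linear : linear clin_fun;
  clin_bounded : op_bounded nE nF clin_fun }.

Lemma clinP (S T : clin) : (forall x, S x = T x) -> S = T.
Proof.
case: S T => [f fl fb] [g gl gb] /= /funext fg.
by move: fl fb gl gb; rewrite fg => *; congr CLin; exact: Prop_irrelevance.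
Qed.

HB.instance Definition _ := gen_eqMixin clin.
HB.instance Definition _ := gen_choiceMixin clin.

Let nEZ (r : R) (x : E) : nE (r *: x) = `|r| * nE x. Proof. exact: normrZ. Qed.
Let nFZ (r : R) (x : F) : nF (r *: x) = `|r| * nF x. Proof. exact: normrZ. Qed.
Let nFD (x y : F) : nF (x + y) <= nF x + nF y. Proof. exact: ler_normD. Qed.
Let nE_ge0 x : 0 <= nE x. Proof. exact: normr_ge0. Qed.
Let nF_ge0 x : 0 <= nF x. Proof. exact: normr_ge0. Qed.
Let nE0 x : nE x = 0 -> x = 0. Proof. exact: normr0_eq0. Qed.
Let nF0 x : nF x = 0 -> x = 0. Proof. exact: normr0_eq0. Qed.

Definition clin_zero : clin.
Proof.
exists (fun=> 0) => [a u v|]; first by rewrite scaler0 addr0.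
by exists 0 => x; rewrite mul0r /nF normr0.
Defined.

Definition clin_add (S T : clin) : clin.
Proof.
exists (fun x => S x + T x) => [a u v|].
  by rewrite !clin_linear scalerDr addrACA.
exact: op_boundedD nFD _ _ (clin_bounded S) (clin_bounded T).
Defined.

Definition clin_scale (r : R) (T : clin) : clin.
Proof.
exists (fun x => r *: T x) => [a u v|].
  by rewrite clin_linear scalerDr !scalerA mulrC.
exact: op_boundedZ nFZ r _ (clin_bounded T).
Defined.

Lemma clin_addA : associative clin_add.
Proof. by move=> S T U; apply: clinP => x /=; rewrite addrA. Qed.

Lemma clin_addC : commutative clin_add.
Proof. by move=> S T; apply: clinP => x /=; rewrite addrC. Qed.

Lemma clin_add0 : left_id clin_zero clin_add.
Proof. by move=> S; apply: clinP => x /=; rewrite add0r. Qed.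

Lemma clin_addN : left_inverse clin_zero (clin_scale (-1)) clin_add.
Proof. by move=> S; apply: clinP => x /=; rewrite scaleN1r addNr. Qed.

HB.instance Definition _ :=
  GRing.isZmodule.Build clin clin_addA clin_addC clin_add0 clin_addN.

Lemma clin_scaleA (r s : R) (T : clin) :
  clin_scale r (clin_scale s T) = clin_scale (r * s) T.
Proof. by apply: clinP => x /=; rewrite scalerA. Qed.

Lemma clin_scale1 : left_id 1 clin_scale.
Proof. by move=> T; apply: clinP => x /=; rewrite scale1r. Qed.

Lemma clin_scaleDr : right_distributive clin_scale +%R.
Proof. by move=> r S T; apply: clinP => x /=; rewrite scalerDr. Qed.

Lemma clin_scaleDl (T : clin) : {morph clin_scale^~ T : r s / r + s}.
Proof. by move=> r s; apply: clinP => x /=; rewrite scalerDl. Qed.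

HB.instance Definition _ := GRing.Zmodule_isLmodule.Build R clin
  clin_scaleA clin_scale1 clin_scaleDr clin_scaleDl.

Definition clin_norm (T : clin) : R := opnorm nE nF T.

Lemma clin_normD S T : clin_norm (S + T) <= clin_norm S + clin_norm T.
Proof. by apply: (opnormD nE_ge0 nEZ nFD); exact: clin_bounded. Qed.

Lemma clin_normZ (r : R) T : clin_norm (r *: T) = `|r| * clin_norm T.
Proof. by apply: (@opnormZ _ _ _ _ id) => //; exact: clin_bounded. Qed.

Lemma clin_norm0_eq0 T : clin_norm T = 0 -> T = 0.
Proof.
move=> T0; apply: clinP.
apply: (opnorm_eq0 nE0 nE_ge0 nEZ nF0 nF_ge0 nFZ) => //.
- exact: clin_bounded.
- exact: clin_linear.
Qed.

HB.instance Definition _ :=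
  Lmodule_isNormed.Build R clin clin_normD clin_normZ clin_norm0_eq0.

End ContinuousLinear.
Arguments clin {R} E F.

Section Smooth.
Context {R : realType} {E : normedModType R}.

(* The Fréchet derivative ['d f x] as an element of the normed space [clin E F]
   (meaningful only where [f] is differentiable, see [fderivE]). *)
Definition fderiv (F : normedModType R) (f : E -> F) (x : E) : clin E F :=
  get [set l : clin E F | (l : E -> F) = 'd f x].

Lemma fderivE (F : normedModType R) (f : E -> F) (x : E) :
  differentiable f x -> fderiv f x = 'd f x :> (E -> F).
Proof.
move=> dfx; have /(_ 0) /continuous_linear_bounded/linear_boundedP := diff_continuous dfx.
move=> dfb; have lb : op_bounded (fun v : E => `|v|) (fun v : F => `|v|) ('d f x).
  by near +oo_R => r; exists r; near: r.
have ll : linear ('d f x) by move=> a u v; rewrite linearP.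
exact: (@getPex _ [set l : clin E F | (l : E -> F) = 'd f x]
  (ex_intro _ (CLin ll lb) erefl)).
Unshelve. all: by end_near. Qed.

(* [U] is meant to be open. *)
Fixpoint Cn (n : nat) (F : normedModType R) (U : set E) (f : E -> F) : Prop :=
  match n with
  | 0 => forall x, U x -> {for x, continuous f}
  | n'.+1 => (forall x, U x -> differentiable f x) /\ Cn n' U (fderiv f)
  end.

Definition smooth_on (F : normedModType R) (U : set E) (f : E -> F) :=
  forall n, Cn n U f.

End Smooth.

Section Submanifold.
Context {R : realType} {E : normedModType R}.

(* [S] is a closed subspace of [T] having a closed complement in [T]. *)
Definition complemented_in (T S : set E) :=
  [/\ closed_linear S, S `<=` T &
   exists S' : set E, [/\ closed_linear S', S' `<=` T, S `&` S' = [set 0] &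
     forall v, T v -> exists2 s, S s & exists2 s', S' s' & v = s + s']].

(* A smooth diffeomorphism [phi] from an open neighbourhood [O] of [p] onto an
   open set [O'], with inverse [psi], flattening [M] onto the complemented
   subspace [S]. *)
Record slice_chart (M : set E) (p : E) (O O' : set E) (phi psi : E -> E)
    (S : set E) : Prop := SliceChart {
  slice_open : open O;
  slice_open' : open O';
  slice_center : O p;
  slice_smooth : smooth_on O phi;
  slice_smooth' : smooth_on O' psi;
  slice_image : phi @` O = O';
  slice_cancel : forall x, O x -> psi (phi x) = x;
  slice_complemented : complemented_in setT S;
  slice_flat : phi @` (O `&` M) = O' `&` S }.

Definition complemented_submanifold (M : set E) :=
  forall p, M p -> exists O O' phi psi S, slice_chart M p O O' phi psi S.

(* Velocities at [p] of the smooth curves drawn on [M]. *)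
Definition tangent_space (M : set E) (p : E) : set E :=
  [set v | exists (c : R^o -> E) (I : set R^o),
    [/\ open I, I 0, smooth_on I c, forall t, I t -> M (c t) &
        c 0 = p /\ 'd c 0 1 = v]].

End Submanifold.

Section Submersion.
Context {R : realType} {E F : normedModType R}.

(* [g] is a smooth extension of the map [f] on [M] to an ambient neighbourhood
   of [p]; the differential of [f] at [p] is then ['d g p] restricted to
   [tangent_space M p]. *)
Definition smooth_extension (M : set E) (f : E -> F) (p : E) (g : E -> F) :=
  exists O : set E,
    [/\ open O, O p, smooth_on O g & forall x, O x -> M x -> g x = f x].

Definition smooth_on_submanifold (M : set E) (f : E -> F) :=
  forall p, M p -> exists g, smooth_extension M f p g.

Definition submersion (M : set E) (N : set F) (f : E -> F) :=
  [/\ forall p, M p -> N (f p),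
      smooth_on_submanifold M f &
      forall p g, M p -> smooth_extension M f p g ->
        'd g p @` tangent_space M p = tangent_space N (f p) /\
        complemented_in (tangent_space M p)
          (tangent_space M p `&` [set v | 'd g p v = 0])].

End Submersion.

Section ProjDiff.
Context {R : realType} {H : hilbertType R}.
Implicit Types A T P Q : bop H.

(* The adjoint exists and is unique since [H] is complete. *)
Definition adj T : bop H :=
  get [set S : bop H | forall x y, inner (T x) y = inner x (S y)].

Definition orthogonal_projection P := P * P = P /\ adj P = P.

Lemma orthogonal_projection_sym P : orthogonal_projection P ->
  forall x y, inner (P x) y = inner x (P y).
Proof.
move=> [_ PE]; rewrite /adj in PE; move: PE.
case: xgetP => [/= S -> SP PE|_ <- x y]; last by rewrite /= inner0l inner0r.
by rewrite -{2}PE.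
Qed.

Definition projection_difference : set (bop H) :=
  [set A | exists P Q,
    [/\ orthogonal_projection P, orthogonal_projection Q & A = P - Q]].

Definition nullspace T : set H := [set x | T x = 0].

(* (N(A) + N(A^2 - 1))^perp *)
Definition generic_space A : csubspace H :=
  orthoc [set z | exists x y,
    [/\ nullspace A x, nullspace (A ^+ 2 - 1) y & z = x + y]].

Lemma generic_space_invariant A : projection_difference A ->
  forall x, csub_set (generic_space A) x -> csub_set (generic_space A) (A x).
Proof.
move=> [P [Q [/orthogonal_projection_sym Ps /orthogonal_projection_sym Qs AE]]].
have As u v : inner (A u) v = inner u (A v).
  by rewrite AE !bop_subE innerBl innerBr Ps Qs.
move=> x Gx z [u [v [Au Av ->]]]; rewrite -As bopD Au add0r.
apply: Gx; exists 0, (A v); split; [exact: bop0| |by rewrite add0r].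
move: Av; rewrite /nullspace /mkset !bop_subE !expr2 /= => /eqP.
by rewrite subr_eq0 => /eqP ->; rewrite subrr.
Qed.

Definition restriction (S : csubspace H) T
    (TS : forall x, csub_set S x -> csub_set S (T x)) : bop (csub S).
Proof.
exists (fun x => CSub (introT (asboolP _) (TS _ (csub_in x)))) => [a u v|].
  by apply: val_inj; rewrite /= bop_linear.
by have [M TM] := bop_bounded T; exists M => x; exact: TM.
Defined.

Definition generic_part A (DA : projection_difference A) :
    bop (csub (generic_space A)) :=
  restriction (generic_space_invariant DA).

Definition projection_pairs A : set (bop H * bop H) :=
  [set PQ | [/\ orthogonal_projection PQ.1, orthogonal_projection PQ.2 &
                PQ.1 - PQ.2 = A]].

Definition unitary T := T * adj T = 1 /\ adj T * T = 1.

(* The unitary group of [commutant A], as a subset of this Banach space, from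
   which it inherits its topology and its structure of real Banach-Lie group. *)
Definition commutant_unitary A : set (csub (commutant A)) :=
  [set U | unitary (csub_val U)].

Definition unitary_orbit A P Q (U : csub (commutant A)) : bop H * bop H :=
  let u := csub_val U in (u * P * adj u, u * Q * adj u).

End ProjDiff.
Arguments commutant_unitary {R H} A.

(* Main.v *)
(** Write [E = P + Q - 1] for a pair of projections with [P - Q = A]: the pairs
    correspond to the self-adjoint [E] with [E A = - A E] and [E^2 = 1 - A^2].
    On the generic part the closed range hypothesis makes [1 - A^2], hence [E],
    invertible.  The Cayley transform [F |-> (F - E) (F + E)^-1 E] is then a
    diffeomorphism between open sets of operators, and it maps the roots [F]
    exactly onto the real subspace [T] of the self-adjoint [X] anticommuting with
    [A] and [E].  Such [X] are those anticommuting with the symmetries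
    [s = E + A] and [t = E - A], so [T] is complemented by averaging (with a
    Banach limit) over the powers of the unitary [t s], then symmetrizing.

    The tangent space of the unitary group at [u] consists of the [v = Y u] with
    [Y] anti-Hermitian commuting with [A], and the differential of the orbit map
    sends [v] to the commutators of [Y] with the two projections at [u].  Its
    kernel is [Y E = E Y], and since [E^2] commutes with [Y], conjugation by [E]
    is an involution whose antifixed points give the complement; [Y = X E^-1] is
    a preimage of the tangent vector [(X, X)]. *)

Require Import Defs.
From HB Require Import structures.
From mathcomp Require Import all_boot all_order all_algebra.
From mathcomp Require Import all_classical all_reals all_analysis.
From mathcomp Require Import complex ring lra.

Set Implicit Arguments.
Unset Strict Implicit.
Unset Printing Implicit Defensive.

Import Order.TTheory GRing.Theory Num.Theory.
Import numFieldNormedType.Exports.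

Local Open Scope classical_set_scope.
Local Open Scope ring_scope.

(** The pairs form no linear space and the operator norm in general comes from no inner product, so
    the chart and the complements must be built by hand. The symmetries are [s = 2P - 1] and
    [t = 2Q - 1]; they generate a dihedral group whose subgroup of powers of [t s] is commutative
    and so carries an invariant mean. This is why a Banach limit gives a bounded projection even
    when the group is infinite. For [X] in [T] the operator [B = X E^-1] is anti-Hermitian and
    commutes with [A], and the inverse of the chart is [(1 + B) (1 - B)^-1 E], the classical Cayley
    transform of [B] acting on [E]. Being rational, it is smooth by product and inversion rules
    alone; the same transform replaces the exponential when curves of unitaries are drawn. Closed
    range enters because a self-adjoint operator with closed range maps onto the orthogonal
    complement of its kernel, and the generic space is orthogonal to the kernel of [A^2 - 1]. *)

(** * Bounded linear maps between real normed spaces *)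

Section ContinuousLinearTheory.
Context {R : realType}.
Implicit Types E F G : normedModType R.

Lemma clinD E F (L : clin E F) x y : L (x + y) = L x + L y.
Proof. by have := clin_linear L 1 x y; rewrite !scale1r. Qed.

Lemma clin0 E F (L : clin E F) : L 0 = 0.
Proof. by apply: (addrI (L 0)); rewrite -clinD !addr0. Qed.

Lemma clinZ E F (L : clin E F) r x : L (r *: x) = r *: L x.
Proof. by have := clin_linear L r x 0; rewrite clin0 !addr0. Qed.

Lemma clinN E F (L : clin E F) x : L (- x) = - L x.
Proof. by rewrite -scaleN1r clinZ scaleN1r. Qed.

Lemma clinB E F (L : clin E F) x y : L (x - y) = L x - L y.
Proof. by rewrite clinD clinN. Qed.

Lemma clin_normP E F (L : clin E F) x : `|L x| <= `|L| * `|x|.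
Proof.
apply: (@opnormP _ _ _ _ id (fun v : E => `|v|) (fun v : F => `|v|)) => //.
- exact: normr0_eq0.
- by move=> r v; rewrite normrZ.
- by move=> r v; rewrite normrZ.
- exact: clin_bounded.
- exact: clin_linear.
Qed.

Lemma clin_norm_le E F (L : clin E F) (M : R) : 0 <= M ->
  (forall x, `|L x| <= M * `|x|) -> `|L| <= M.
Proof.
move=> M0 LM; apply: (@opnorm_le _ _ _ _ id (fun v : E => `|v|) (fun v : F => `|v|)).
- by move=> r v; rewrite normrZ.
- by move=> x x1; apply: le_trans (LM x) _; rewrite ler_piMr.
Qed.

Lemma clin_continuous E F (L : clin E F) : continuous L.
Proof.
move=> x; apply/cvgrPdist_le => e e0; near=> y; rewrite -clinB.
apply: le_trans (clin_normP _ _) _.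
apply: (@le_trans _ _ ((`|L| + 1) * `|x - y|)); first by rewrite ler_wpM2r// lerDl.
rewrite mulrC -ler_pdivlMr ?ltr_wpDl//.
near: y; apply: cvgr_dist_le; [exact: cvg_id|by rewrite divr_gt0 ?ltr_wpDl].
Unshelve. all: by end_near. Qed.

Lemma clin_kernel_closed_linear E F (L : clin E F) :
  closed_linear [set x | L x = 0].
Proof.
split=> [|a u v /= Lu Lv|]; [exact: clin0|by rewrite clinD clinZ Lu Lv scaler0 addr0|].
rewrite (_ : [set x | _] = L @^-1` [set 0]) //.
apply: preimage_closed; last exact/accessible_closed_set1/hausdorff_accessible/norm_hausdorff.
by move=> x _; exact: clin_continuous.
Qed.

End ContinuousLinearTheory.

Lemma closed_linearI (K : numFieldType) (V : normedModType K) (S T : set V) :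
  closed_linear S -> closed_linear T -> closed_linear (S `&` T).
Proof.
move=> [S0 SL Sc] [T0 TL Tc]; split => //; last exact: closedI.
by move=> a u v [Su Tu] [Sv Tv]; split; [exact: SL|exact: TL].
Qed.

(** * Bounded bilinear maps and the operators they induce *)

Section BoundedBilinear.
Context {R : realType}.
Implicit Types E F G K : normedModType R.

Record bounded_bilinear F G K (b : F -> G -> K) : Prop := BoundedBilinear {
  bbil_linearl : forall v, linear (b^~ v);
  bbil_linearr : forall u, linear (b u);
  bbil_bounded : exists2 M : R, 0 <= M & forall u v, `|b u v| <= M * (`|u| * `|v|) }.

Section Basics.
Context F G K (b : F -> G -> K) (bb : bounded_bilinear b).

Lemma bbilDl u u' v : b (u + u') v = b u v + b u' v.
Proof. by have := bbil_linearl bb v 1 u u'; rewrite !scale1r. Qed.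

Lemma bbilDr u v v' : b u (v + v') = b u v + b u v'.
Proof. by have := bbil_linearr bb u 1 v v'; rewrite !scale1r. Qed.

Lemma bbil0l v : b 0 v = 0.
Proof. by apply: (addrI (b 0 v)); rewrite -bbilDl !addr0. Qed.

Lemma bbil0r u : b u 0 = 0.
Proof. by apply: (addrI (b u 0)); rewrite -bbilDr !addr0. Qed.

Lemma bbilZl r u v : b (r *: u) v = r *: b u v.
Proof. by have := bbil_linearl bb v r u 0; rewrite bbil0l !addr0. Qed.

Lemma bbilZr r u v : b u (r *: v) = r *: b u v.
Proof. by have := bbil_linearr bb u r v 0; rewrite bbil0r !addr0. Qed.

Lemma bbilNl u v : b (- u) v = - b u v.
Proof. by rewrite -scaleN1r bbilZl scaleN1r. Qed.

Lemma bbilNr u v : b u (- v) = - b u v.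
Proof. by rewrite -scaleN1r bbilZr scaleN1r. Qed.

Lemma bbilBl u u' v : b (u - u') v = b u v - b u' v.
Proof. by rewrite bbilDl bbilNl. Qed.

Lemma bbilBr u v v' : b u (v - v') = b u v - b u v'.
Proof. by rewrite bbilDr bbilNr. Qed.

Definition bbil_postcomp E (u : F) (N : clin E G) : clin E K.
Proof.
exists (fun h => b u (N h)) => [a x y|].
  by rewrite clinD clinZ bbilDr bbilZr.
have [M M0 bM] := bbil_bounded bb; exists (M * (`|u| * `|N|)) => x.
apply: le_trans (bM _ _) _; rewrite -[leRHS]mulrA ler_wpM2l// -mulrA ler_wpM2l//.
exact: clin_normP.
Defined.

Definition bbil_precomp E (N : clin E F) (v : G) : clin E K.
Proof.
exists (fun h => b (N h) v) => [a x y|].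
  by rewrite clinD clinZ bbilDl bbilZl.
have [M M0 bM] := bbil_bounded bb; exists (M * (`|N| * `|v|)) => x.
apply: le_trans (bM _ _) _; rewrite -[leRHS]mulrA ler_wpM2l// mulrAC ler_wpM2r//.
exact: clin_normP.
Defined.

(** With [bbil_precomp_bilinear], this closes the induction of [Cn_bbil]: the two terms of the
    Leibniz rule are again bounded bilinear expressions, in one factor and the derivative of the
    other. *)
Lemma bbil_postcomp_bilinear E : bounded_bilinear (@bbil_postcomp E).
Proof.
split=> [N a u u'|u a N N'|].
- by apply: clinP => h /=; rewrite bbilDl bbilZl.
- by apply: clinP => h /=; rewrite bbilDr bbilZr.
have [M M0 bM] := bbil_bounded bb; exists M => // u N.
apply: clin_norm_le => [|x]; first by rewrite !mulr_ge0.
apply: le_trans (bM _ _) _; rewrite -[leRHS]mulrA ler_wpM2l// -mulrA ler_wpM2l//.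
exact: clin_normP.
Qed.

Lemma bbil_precomp_bilinear E : bounded_bilinear (@bbil_precomp E).
Proof.
split=> [v a N N'|N a v v'|].
- by apply: clinP => h /=; rewrite bbilDl bbilZl.
- by apply: clinP => h /=; rewrite bbilDr bbilZr.
have [M M0 bM] := bbil_bounded bb; exists M => // N v.
apply: clin_norm_le => [|x]; first by rewrite !mulr_ge0.
apply: le_trans (bM _ _) _; rewrite -[leRHS]mulrA ler_wpM2l// mulrAC ler_wpM2r//.
exact: clin_normP.
Qed.

End Basics.

Definition clin_comp E F G (L : clin F G) (N : clin E F) : clin E G.
Proof.
exists (fun h => L (N h)) => [a x y|]; first by rewrite !(clinD, clinZ).
exists (`|L| * `|N|) => x; apply: le_trans (clin_normP _ _) _.
by rewrite -mulrA ler_wpM2l// clin_normP.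
Defined.

Definition clin_postcomp E F G (L : clin F G) : clin (clin E F) (clin E G).
Proof.
exists (clin_comp L) => [a N N'|]; first by apply: clinP => h /=; rewrite clinD clinZ.
exists `|L| => N; apply: clin_norm_le => [|x]; first by rewrite mulr_ge0.
by apply: le_trans (clin_normP L _) _; rewrite -mulrA ler_wpM2l// clin_normP.
Defined.

Definition clin_id E : clin E E.
Proof. by exists id => //; exists 1 => x; rewrite mul1r. Defined.

Definition clin_inl F G : clin F (F * G)%type.
Proof.
exists (fun u => (u, 0)) => [a u v|].
  by apply/eqP; rewrite xpair_eqE /= scaler0 addr0 !eqxx.
by exists 1 => x; rewrite mul1r prod_normE /= normr0 ge_max lexx normr_ge0.
Defined.

Definition clin_inr F G : clin G (F * G)%type.
Proof.
exists (fun u => (0, u)) => [a u v|].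
  by apply/eqP; rewrite xpair_eqE /= scaler0 addr0 !eqxx.
by exists 1 => x; rewrite mul1r prod_normE /= normr0 ge_max lexx normr_ge0.
Defined.

Definition clin_fst F G : clin (F * G)%type F.
Proof.
by exists fst => //; exists 1 => x; rewrite mul1r prod_normE le_max lexx.
Defined.

Definition clin_snd F G : clin (F * G)%type G.
Proof.
by exists snd => //; exists 1 => x; rewrite mul1r prod_normE le_max lexx orbT.
Defined.

End BoundedBilinear.

(** * Fréchet derivatives and the Leibniz rule *)

Section FrechetDerivative.
Context {R : realType} {E : normedModType R}.
Implicit Types F G K : normedModType R.

(** The derivative is an explicit element of [clin E F] because [Cn] is iterated on [fderiv], a map
    into that normed space. *)
Definition frechet F (f : E -> F) (x : E) (l : clin E F) :=
  forall e : R, 0 < e ->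
    \forall y \near x, `|f y - f x - l (y - x)| <= e * `|y - x|.

Lemma differentiable_frechet F (f : E -> F) x :
  differentiable f x -> frechet f x (fderiv f x).
Proof.
move=> df e e0; rewrite fderivE//.
have /eqaddoP/(_ e e0) := diff_locally df.
rewrite [X in X -> _](near_shift x) sub0r; apply: filterS => y.
by rewrite /= !fctE /= subrK opprD addrA.
Qed.

Lemma frechet_diff F (f : E -> F) x (l : clin E F) :
  frechet f x l -> differentiable f x /\ 'd f x = l :> (E -> F).
Proof.
move=> fl.
pose ll : {linear E -> F} :=
  HB.pack (l : E -> F) (GRing.isLinear.Build _ _ _ _ _ (clin_linear l)).
have lc : continuous ll by exact: clin_continuous.
have lo : f \o shift x = cst (f x) + ll +o_ 0 id.
  apply/eqaddoP => e e0; have := fl e e0.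
  rewrite (near_shift 0) subr0; apply: filterS => y /=.
  by rewrite /= !fctE /= addrK opprD addrA.
have dE := diff_unique lc lo; split => //.
apply/diff_locallyP; split; first by rewrite dE.
by rewrite dE.
Qed.

Lemma frechet_fderiv F (f : E -> F) x (l : clin E F) :
  frechet f x l -> fderiv f x = l.
Proof.
move=> /frechet_diff[df dE]; apply: clinP => h.
by have := fderivE df; rewrite dE => ->.
Qed.

Lemma frechet_continuous F (f : E -> F) x (l : clin E F) :
  frechet f x l -> {for x, continuous f}.
Proof. by move=> /frechet_diff[df _]; exact: differentiable_continuous. Qed.

Lemma frechet_lipschitz F (f : E -> F) x (l : clin E F) :
  frechet f x l -> \forall y \near x, `|f y - f x| <= (`|l| + 1) * `|y - x|.
Proof.
move=> /(_ 1 ltr01) fl; near=> y.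
rewrite -[f y - f x](subrK (l (y - x))) addrC mulrDl.
apply: le_trans (ler_normD _ _) _; apply: lerD; first exact: clin_normP.
by near: y.
Unshelve. all: by end_near. Qed.

Lemma frechet_cst F (a : F) x : frechet (fun=> a) x 0.
Proof.
by move=> e e0; near=> y; rewrite subrr/= subrr normr0 mulr_ge0// ltW.
Unshelve. all: by end_near. Qed.

Lemma frechet_clin F (L : clin E F) x : frechet L x L.
Proof.
by move=> e e0; near=> y; rewrite -clinB subrr normr0 mulr_ge0// ltW.
Unshelve. all: by end_near. Qed.

Lemma frechet_add F (f g : E -> F) x f' g' :
  frechet f x f' -> frechet g x g' -> frechet (fun y => f y + g y) x (f' + g').
Proof.
move=> ff gg e e0; have e20 : 0 < e / 2 by rewrite divr_gt0.
near=> y.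
have -> : f y + g y - (f x + g x) - (f' + g' : clin E F) (y - x) =
  (f y - f x - f' (y - x)) + (g y - g x - g' (y - x)).
  by rewrite /= !opprD !addrA; rewrite [RHS](AC 6 (1*4*2*5*3*6))/=.
apply: le_trans (ler_normD _ _) _; rewrite [e]splitr mulrDl; apply: lerD.
  by near: y; exact: ff.
by near: y; exact: gg.
Unshelve. all: by end_near. Qed.

Lemma frechet_comp_clin F G (L : clin F G) (f : E -> F) x f' :
  frechet f x f' -> frechet (fun y => L (f y)) x (clin_comp L f').
Proof.
move=> ff e e0; have d0 : 0 < e / (`|L| + 1) by rewrite divr_gt0// ltr_wpDl.
near=> y; rewrite /= -!clinB; apply: le_trans (clin_normP _ _) _.
apply: (@le_trans _ _ ((`|L| + 1) * (e / (`|L| + 1) * `|y - x|))).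
  by apply: ler_pM => //; [rewrite lerDl|near: y; exact: ff].
by rewrite mulrA mulrCA divff ?mulr1// gt_eqF// ltr_wpDl.
Unshelve. all: by end_near. Qed.

Lemma frechet_bbil F G K (b : F -> G -> K) (bb : bounded_bilinear b)
    (f : E -> F) (g : E -> G) x f' g' :
  frechet f x f' -> frechet g x g' ->
  frechet (fun y => b (f y) (g y)) x
    (bbil_postcomp bb (f x) g' + bbil_precomp bb f' (g x)).
Proof.
move=> ff gg e e0; have [M M0 bM] := bbil_bounded bb.
(* The coefficients of the three error terms below, [|f x| + 1] being a bound for [|f y|] near [x];
   the last [1] makes [c] positive. *)
pose c := M * (`|f x| + 1 + `|g x| + `|g'|) + 1.
have c0 : 0 < c by rewrite ltr_wpDl// !(mulr_ge0, addr_ge0).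
have d0 : 0 < e / c by rewrite divr_gt0.
have fc := frechet_continuous ff.
near=> y.
(* The remainder is the linearization error of [g], that of [f], and a mixed term which is small
   because [f] is continuous at [x]. *)
have -> : b (f y) (g y) - b (f x) (g x) -
    (bbil_postcomp bb (f x) g' + bbil_precomp bb f' (g x) : clin E K) (y - x) =
    b (f y) (g y - g x - g' (y - x)) + b (f y - f x - f' (y - x)) (g x) +
    b (f y - f x) (g' (y - x)).
  rewrite /= !(bbilBr bb) !(bbilBl bb) opprD !addrA.
  by rewrite [RHS](ACl (1*5*8*6*(2*4)*(3*7)))/= !addNr !addr0.
have fy1 : `|f y| <= `|f x| + 1.
  rewrite -[f y](subrK (f x)) addrC; apply: le_trans (ler_normD _ _) _.
  rewrite lerD2l distrC; near: y; exact: cvgr_dist_le.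
have fye : `|f y - f x| <= e / c.
  rewrite distrC; near: y; exact: cvgr_dist_le.
have rf : `|f y - f x - f' (y - x)| <= e / c * `|y - x| by near: y; exact: ff.
have rg : `|g y - g x - g' (y - x)| <= e / c * `|y - x| by near: y; exact: gg.
apply: (@le_trans _ _ (c * (e / c * `|y - x|))); last first.
  by rewrite mulrA mulrCA divff ?mulr1// gt_eqF.
apply: (@le_trans _ _ (M * ((`|f x| + 1) * (e / c * `|y - x|)) +
    M * ((e / c * `|y - x|) * `|g x|) + M * (e / c * (`|g'| * `|y - x|)))).
  apply: le_trans (ler_normD _ _) _; apply: lerD.
    apply: le_trans (ler_normD _ _) _; apply: lerD.
      by apply: le_trans (bM _ _) _; rewrite ler_wpM2l// ler_pM.
    by apply: le_trans (bM _ _) _; rewrite ler_wpM2l// ler_pM.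
  by apply: le_trans (bM _ _) _; rewrite ler_wpM2l// ler_pM// clin_normP.
move: (e / c) (ltW d0) => t t0; move: (`|y - x|) (normr_ge0 (y - x)) => h h0.
have -> : M * ((`|f x| + 1) * (t * h)) + M * (t * h * `|g x|) + M * (t * (`|g'| * h)) =
   (c - 1) * (t * h).
  by rewrite /c; ring.
by apply: ler_wpM2r; [rewrite mulr_ge0|rewrite lerBlDr lerDl].
Unshelve. all: by end_near. Qed.

End FrechetDerivative.

(** * Calculus of maps of class [Cn] on an open set *)

Section SmoothCalculus.
Context {R : realType} {E : normedModType R} (U : set E).
Hypothesis Uopen : open U.
Implicit Types F G K : normedModType R.

Lemma Cn_frechet n F (f : E -> F) : Cn n.+1 U f ->
  forall x, U x -> frechet f x (fderiv f x).
Proof. by move=> [fd _] x Ux; apply: differentiable_frechet; exact: fd. Qed.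

Lemma frechet_near F (f g : E -> F) x l :
  (\forall y \near x, f y = g y) -> frechet f x l -> frechet g x l.
Proof.
move=> fg fl e e0; near=> y; rewrite -(near fg y)// -(nbhs_singleton fg).
by near: y; exact: fl.
Unshelve. all: by end_near. Qed.

Lemma open_near x (P : E -> Prop) : (forall y, U y -> P y) -> U x ->
  \forall y \near x, P y.
Proof. by move=> UP Ux; apply: filterS UP _; exact: open_nbhs_nbhs. Qed.

(** Nothing is known of [fderiv] off [U], so regularity has to depend on the values on [U] only.
    Since [U] is open, agreement on [U] is agreement near each of its points and passes to
    derivatives. *)
Lemma Cn_eq n F (f g : E -> F) : (forall x, U x -> f x = g x) ->
  Cn n U f -> Cn n U g.
Proof.
elim: n F f g => [|n IHn] F f g fg /=.
  move=> fc x Ux; rewrite /prop_for /continuous_at -fg//.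
  apply: cvg_trans (fc x Ux); apply: near_eq_cvg.
  exact: (open_near fg).
move=> fC; have [fd fC'] := fC.
have gF x : U x -> frechet g x (fderiv f x).
  by move=> Ux; apply: (frechet_near (open_near fg Ux)); exact: (Cn_frechet fC).
split; first by move=> x /gF/frechet_diff[].
by apply: IHn fC' => x Ux; rewrite (frechet_fderiv (gF x Ux)).
Qed.

Lemma CnW n F (f : E -> F) : Cn n.+1 U f -> Cn n U f.
Proof.
elim: n F f => [|n IHn] F f [fd fC] /=.
  by move=> x Ux; exact/differentiable_continuous/fd.
by split => //; exact: IHn.
Qed.

(** The induction step of the rules below: exhibit a derivative on [U], then show that it is one
    class less regular. *)
Lemma CnS n F (f : E -> F) (f' : E -> clin E F) :
  (forall x, U x -> frechet f x (f' x)) -> Cn n U f' -> Cn n.+1 U f.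
Proof.
move=> ff fC; split; first by move=> x /ff/frechet_diff[].
by apply: Cn_eq fC => x Ux; rewrite (frechet_fderiv (ff x Ux)).
Qed.

Lemma Cn_cst n F (a : F) : Cn n U (fun=> a).
Proof.
elim: n F a => [|n IHn] F a; first by move=> x _; exact: cst_continuous.
by apply: (@CnS _ _ _ (fun=> 0)) (IHn _ _) => x _; exact: frechet_cst.
Qed.

Lemma Cn_clin n F (L : clin E F) : Cn n U L.
Proof.
case: n => [|n]; first by move=> x _; exact: clin_continuous.
by apply: (@CnS _ _ _ (fun=> L)) (Cn_cst _ _) => x _; exact: frechet_clin.
Qed.

Lemma Cn_id n : Cn n U id.
Proof. exact: (@Cn_clin _ _ (clin_id E)). Qed.

Lemma Cn_comp_clin n F G (L : clin F G) (f : E -> F) :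
  Cn n U f -> Cn n U (fun x => L (f x)).
Proof.
elim: n F G L f => [|n IHn] F G L f fC.
  by move=> x Ux; apply: continuous_comp; [exact: fC|exact: clin_continuous].
apply: (@CnS _ _ _ (fun x => clin_postcomp E L (fderiv f x))); last by apply: IHn; case: fC.
by move=> x Ux; apply: frechet_comp_clin; exact: (Cn_frechet fC).
Qed.

Lemma Cn_add n F (f g : E -> F) :
  Cn n U f -> Cn n U g -> Cn n U (fun x => f x + g x).
Proof.
elim: n F f g => [|n IHn] F f g fC gC.
  by move=> x Ux; apply: cvgD; [exact: fC|exact: gC].
apply: (@CnS _ _ _ (fun x => fderiv f x + fderiv g x)); last first.
  by apply: IHn; [case: fC|case: gC].
by move=> x Ux; apply: frechet_add; [exact: (Cn_frechet fC)|exact: (Cn_frechet gC)].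
Qed.

Definition clin_opp F : clin F F.
Proof.
exists -%R => [a u v|]; first by rewrite opprD scalerN.
by exists 1 => x; rewrite normrN mul1r.
Defined.

Lemma Cn_opp n F (f : E -> F) : Cn n U f -> Cn n U (fun x => - f x).
Proof. exact: (Cn_comp_clin (clin_opp F)). Qed.

Lemma Cn_sub n F (f g : E -> F) :
  Cn n U f -> Cn n U g -> Cn n U (fun x => f x - g x).
Proof. by move=> fC gC; apply: Cn_add => //; exact: Cn_opp. Qed.

Lemma Cn_pair n F G (f : E -> F) (g : E -> G) :
  Cn n U f -> Cn n U g -> Cn n U (fun x => (f x, g x)).
Proof.
move=> fC gC.
have -> : (fun x => (f x, g x)) = (fun x => clin_inl F G (f x) + clin_inr F G (g x)).
  by apply/funext => x; apply/eqP; rewrite xpair_eqE /= addr0 add0r !eqxx.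
by apply: Cn_add; exact: Cn_comp_clin.
Qed.

Lemma Cn_bbil n F G K (b : F -> G -> K) (f : E -> F) (g : E -> G) :
  bounded_bilinear b -> Cn n U f -> Cn n U g -> Cn n U (fun x => b (f x) (g x)).
Proof.
move=> bb; elim: n F G K b bb f g => [|n IHn] F G K b bb f g fC gC.
  move=> x Ux; have [M M0 bM] := bbil_bounded bb.
  have fc : f y @[y --> x] --> f x by exact: fC.
  have gc : g y @[y --> x] --> g x by exact: gC.
  apply/cvgrPdist_le => e e0.
  pose c := M * (`|f x| + 1 + `|g x|) + 1.
  have c0 : 0 < c by rewrite ltr_wpDl// !(mulr_ge0, addr_ge0).
  have d0 : 0 < e / c by rewrite divr_gt0.
  near=> y.
  have -> : b (f x) (g x) - b (f y) (g y) = b (f y) (g x - g y) + b (f x - f y) (g x).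
    by rewrite (bbilBr bb) (bbilBl bb) [RHS]addrC addrA subrK.
  have fy1 : `|f y| <= `|f x| + 1.
    rewrite -[f y](subrK (f x)) addrC; apply: le_trans (ler_normD _ _) _.
    rewrite lerD2l distrC; near: y; exact: cvgr_dist_le.
  have fye : `|f x - f y| <= e / c by near: y; exact: cvgr_dist_le.
  have gye : `|g x - g y| <= e / c by near: y; exact: cvgr_dist_le.
  apply: (@le_trans _ _ (c * (e / c))); last by rewrite mulrCA divff ?mulr1// gt_eqF.
  apply: (@le_trans _ _ (M * ((`|f x| + 1) * (e / c)) + M * ((e / c) * `|g x|))).
    apply: le_trans (ler_normD _ _) _; apply: lerD.
      by apply: le_trans (bM _ _) _; rewrite ler_wpM2l// ler_pM.
    by apply: le_trans (bM _ _) _; rewrite ler_wpM2l// ler_pM.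
  move: (e / c) (ltW d0) => t t0.
  have -> : M * ((`|f x| + 1) * t) + M * (t * `|g x|) = (c - 1) * t by rewrite /c; ring.
  by apply: ler_wpM2r; rewrite ?lerBlDr ?lerDl.
apply: (@CnS _ _ _ (fun x => bbil_postcomp bb (f x) (fderiv g x) +
                          bbil_precomp bb (fderiv f x) (g x))).
  by move=> x Ux; apply: frechet_bbil; [exact: (Cn_frechet fC)|exact: (Cn_frechet gC)].
apply: Cn_add.
  by apply: IHn; [exact: bbil_postcomp_bilinear|exact: CnW|case: gC].
by apply: IHn; [exact: bbil_precomp_bilinear|case: fC|exact: CnW].
Unshelve. all: by end_near. Qed.

(* No completeness is needed: the pointwise inverse [g] is assumed to exist, and
   the resolvent identity [g y - g x = - g y * (f y - f x) * g x] controls it. *)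
Section PointwiseInverse.
Context F (m : F -> F -> F) (one : F).
Hypothesis mb : bounded_bilinear m.
Hypothesis mA : associative m.
Hypothesis m1l : left_id one m.
Hypothesis m1r : right_id one m.
Variables f g : E -> F.
Hypothesis fg1 : forall x, U x -> m (f x) (g x) = one.
Hypothesis gf1 : forall x, U x -> m (g x) (f x) = one.

Let resolvent x y : U x -> U y -> g y - g x = - m (g y) (m (f y - f x) (g x)).
Proof.
move=> Ux Uy; rewrite (bbilBl mb) (bbilBr mb) fg1// mA gf1// m1l m1r.
by rewrite opprB.
Qed.

Let inv_dist x : U x -> {for x, continuous f} -> exists2 C : R, 0 <= C &
  \forall y \near x, `|g y - g x| <= C * `|f y - f x|.
Proof.
move=> Ux fc; have [M M0 bM] := bbil_bounded mb.
have mm u v w : `|m u (m v w)| <= M * M * `|w| * (`|u| * `|v|).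
  apply: le_trans (bM _ _) _.
  rewrite -!mulrA ler_wpM2l//.
  apply: (@le_trans _ _ (`|u| * (M * (`|v| * `|w|)))); first by rewrite ler_wpM2l.
  by rewrite mulrCA [`|w| * _]mulrC -mulrA.
pose c := M * M * `|g x|; have c0 : 0 <= c by rewrite !mulr_ge0.
exists (c * (2 * `|g x|)); first by rewrite !mulr_ge0.
near=> y.
have Uy : U y by near: y; exact: open_nbhs_nbhs.
have fy : c * `|f y - f x| <= 2^-1.
  apply: (@le_trans _ _ ((c + 1) * `|f y - f x|)); first by rewrite ler_wpM2r// lerDl.
  rewrite mulrC -ler_pdivlMr ?ltr_wpDl// distrC; near: y.
  by apply: cvgr_dist_le; rewrite ?divr_gt0 ?ltr_wpDl// invr_gt0.
have gd : `|g y - g x| <= c * (`|g y| * `|f y - f x|) by rewrite resolvent// normrN mm.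
(* Absorption: the resolvent identity and [fy] give [|g y| <= |g x| + |g y| / 2], so the inverse is
   bounded near [x] without any prior estimate. *)
have gy : `|g y| <= 2 * `|g x|.
  have h1 : `|g y| <= `|g x| + `|g y - g x|.
    by rewrite -{1}[g y](subrK (g x)) addrC; exact: ler_normD.
  have h2 : c * (`|g y| * `|f y - f x|) <= `|g y| * 2^-1 by rewrite mulrCA ler_wpM2l.
  have h3 : `|g y| = `|g y| * 2^-1 + `|g y| * 2^-1 by rewrite -splitr.
  have h4 : `|g y| * 2^-1 <= `|g x|.
    rewrite -(lerD2r (`|g y| * 2^-1)) -h3; apply: le_trans h1 _.
    by rewrite lerD2l (le_trans gd h2).
  by rewrite mulrC -ler_pdivrMr.
apply: le_trans gd _; rewrite -[leRHS]mulrA ler_wpM2l// ler_wpM2r//.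
Unshelve. all: by end_near. Qed.

Let frechet_inv x l : U x -> frechet f x l ->
  frechet g x (- bbil_postcomp mb (g x) (bbil_precomp mb l (g x))).
Proof.
move=> Ux fl e e0; have [M M0 bM] := bbil_bounded mb.
have fc := frechet_continuous fl.
have mm u v w : `|m u (m v w)| <= M * M * `|w| * (`|u| * `|v|).
  apply: le_trans (bM _ _) _.
  rewrite -!mulrA ler_wpM2l//.
  apply: (@le_trans _ _ (`|u| * (M * (`|v| * `|w|)))); first by rewrite ler_wpM2l.
  by rewrite mulrCA [`|w| * _]mulrC -mulrA.
have [C C0 gC] := inv_dist Ux fc.
have fL := frechet_lipschitz fl.
pose c := M * M * `|g x|; have c0 : 0 <= c by rewrite !mulr_ge0.
pose D := c * (C * (`|l| + 1)) + c * `|g x| + 1.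
have D0 : 0 < D by rewrite ltr_wpDl// !(addr_ge0, mulr_ge0).
have d0 : 0 < e / D by rewrite divr_gt0.
near=> y.
have Uy : U y by near: y; exact: open_nbhs_nbhs.
(* Replacing [g y] by [g x + (g y - g x)] in the resolvent identity leaves a second-order term and
   the linearization error of [f]. *)
have -> : g y - g x - (- bbil_postcomp mb (g x) (bbil_precomp mb l (g x)) : clin E F) (y - x) =
   - (m (g y - g x) (m (f y - f x) (g x)) + m (g x) (m (f y - f x - l (y - x)) (g x))).
  rewrite [in LHS]resolvent//= scaleN1r opprK.
  rewrite (bbilBl mb (g y)) [m (f y - f x - _) _](bbilBl mb) (bbilBr mb (g x)).
  by rewrite addrA subrK opprB addrC.
rewrite normrN; apply: le_trans (ler_normD _ _) _.
have fe : `|f y - f x| <= e / D by rewrite distrC; near: y; exact: cvgr_dist_le.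
have fLy : `|f y - f x| <= (`|l| + 1) * `|y - x| by near: y.
have re : `|f y - f x - l (y - x)| <= e / D * `|y - x| by near: y; exact: fl.
have gCy : `|g y - g x| <= C * `|f y - f x| by near: y.
apply: (@le_trans _ _ (c * (C * (e / D) * ((`|l| + 1) * `|y - x|)) +
                       c * (`|g x| * (e / D * `|y - x|)))).
  apply: lerD; apply: le_trans (mm _ _ _) _; rewrite ler_wpM2l// ler_pM//.
  by apply: le_trans gCy _; rewrite ler_wpM2l.
apply: (@le_trans _ _ (D * (e / D * `|y - x|))); last first.
  by rewrite mulrA mulrCA divff ?mulr1// gt_eqF.
move: (e / D) (ltW d0) => t t0; move: (`|y - x|) (normr_ge0 (y - x)) => h h0.
have -> : c * (C * t * ((`|l| + 1) * h)) + c * (`|g x| * (t * h)) = (D - 1) * (t * h).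
  by rewrite /D; ring.
by apply: ler_wpM2r; [rewrite mulr_ge0|rewrite lerBlDr lerDl].
Unshelve. all: by end_near. Qed.

(** Bootstrapping: the derivative of [g] is the product [- g x * f' * g x], so class [n] of [g] and
    of [fderiv f] yields class [n.+1] of [g]. *)
Lemma Cn_inv n : Cn n U f -> Cn n U g.
Proof.
elim: n => [fC x Ux|n IHn fC].
  have [C C0 gC] := inv_dist Ux (fC x Ux).
  apply/cvgrPdist_le => e e0; near=> y.
  rewrite distrC; apply: (@le_trans _ _ (C * `|f y - f x|)); first by near: y.
  apply: (@le_trans _ _ ((C + 1) * `|f y - f x|)); first by rewrite ler_wpM2r// lerDl.
  rewrite mulrC -ler_pdivlMr ?ltr_wpDl// distrC; near: y.
  by apply: cvgr_dist_le; [exact: fC|rewrite divr_gt0// ltr_wpDl].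
apply: (@CnS _ _ _ (fun x => - bbil_postcomp mb (g x)
                            (bbil_precomp mb (fderiv f x) (g x)))).
  by move=> x Ux; apply: frechet_inv => //; exact: (Cn_frechet fC).
have gC := IHn (CnW fC).
apply/Cn_opp/Cn_bbil => //; first exact: bbil_postcomp_bilinear.
by apply: Cn_bbil => //; [exact: bbil_precomp_bilinear|case: fC].
Unshelve. all: by end_near. Qed.

End PointwiseInverse.

End SmoothCalculus.

(** * The real structure underlying a complex Hilbert space *)

Section RealInner.
Context {R : realType} {H : hilbertType R}.
Implicit Types x y z : H.
Local Open Scope complex_scope.

Lemma ReD (a b : R[i]) : complex.Re (a + b) = complex.Re a + complex.Re b.
Proof. by case: a b => [? ?] [? ?]. Qed.

Lemma ImD (a b : R[i]) : complex.Im (a + b) = complex.Im a + complex.Im b.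
Proof. by case: a b => [? ?] [? ?]. Qed.

Lemma Re_realM (r : R) (a : R[i]) : complex.Re (r%:C * a) = r * complex.Re a.
Proof. by case: a => u v /=; rewrite mul0r subr0. Qed.

Lemma Re_conj (a : R[i]) : complex.Re (Num.conj a) = complex.Re a.
Proof. by case: a. Qed.

Lemma conj_real (r : R) : Num.conj r%:C = r%:C.
Proof. exact: conjc_real. Qed.

Definition rinner x y : R := complex.Re (inner x y).

Lemma rinnerDl x y z : rinner (x + y) z = rinner x z + rinner y z.
Proof. by rewrite /rinner innerDl ReD. Qed.

Lemma rinnerC x y : rinner x y = rinner y x.
Proof. by rewrite /rinner inner_conj Re_conj. Qed.

Lemma rinnerDr x y z : rinner x (y + z) = rinner x y + rinner x z.
Proof. by rewrite rinnerC rinnerDl !(rinnerC x). Qed.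

Lemma rinnerZl (r : R) x y : rinner (r%:C *: x) y = r * rinner x y.
Proof. by rewrite /rinner innerZl Re_realM. Qed.

Lemma rinnerZr (r : R) x y : rinner x (r%:C *: y) = r * rinner x y.
Proof. by rewrite rinnerC rinnerZl rinnerC. Qed.

Lemma rinnerBl x y z : rinner (x - y) z = rinner x z - rinner y z.
Proof. by rewrite /rinner innerBl; case: (inner x z) (inner y z) => [? ?] [? ?]. Qed.

Lemma rinnerBr x y z : rinner x (y - z) = rinner x y - rinner x z.
Proof. by rewrite !(rinnerC x) rinnerBl. Qed.

Lemma rinner_self x : rinner x x = rnorm x ^+ 2.
Proof. by rewrite /rinner inner_norm -rnormE -rmorphXn. Qed.

Lemma rinner_le x y : `|rinner x y| <= rnorm x * rnorm y.
Proof.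
rewrite -lecR; apply: le_trans (normc_ge_Re _) _.
by apply: le_trans (inner_cauchy_schwarz _ _) _; rewrite rmorphM /= !rnormE.
Qed.

Lemma inner_rinner x y : inner x y = rinner x y +i* rinner x ('i *: y).
Proof.
rewrite /rinner innerZr; case: (inner x y) => a b /=.
by rewrite !mul0r sub0r mulNr mul1r opprK.
Qed.

Lemma inner_injr y y' : (forall x, inner x y = inner x y') -> y = y'.
Proof.
move=> yy; apply/eqP; rewrite -subr_eq0; apply/eqP/rnorm_eq0/eqP.
by rewrite -sqrf_eq0 -rinner_self rinnerBr /rinner yy subrr.
Qed.

End RealInner.

Section RealNorm.
Context {R : realType} {V : normedModType R[i]}.
Implicit Types x y : V.
Local Open Scope complex_scope.

Lemma rnormN x : rnorm (- x) = rnorm x.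
Proof. by rewrite /rnorm normrN. Qed.

Lemma rnorm0 : rnorm (0 : V) = 0.
Proof. by rewrite /rnorm normr0. Qed.

Lemma rdistC x y : rnorm (x - y) = rnorm (y - x).
Proof. by rewrite -rnormN opprB. Qed.

Lemma normc_gt0P (e : R[i]) : 0 < e -> exists2 r : R, 0 < r & e = r%:C.
Proof.
case: e => a b; rewrite ltcE /= => /andP[/eqP -> a0].
by exists a.
Qed.

Lemma closed_rnormP (S : set V) : closed S <->
  forall x, (forall e : R, 0 < e -> exists2 y, S y & rnorm (x - y) < e) -> S x.
Proof.
split=> [Sc x xS|Sx x cx].
  apply: Sc => B /nbhs_ballP[e /normc_gt0P[r r0 ->] eB].
  have [y Sy xy] := xS r r0; exists y; split => //; apply: eB.
  by rewrite -ball_normE /= -rnormE ltcR.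
apply: Sx => e e0; have e0' : 0 < e%:C :> R[i] by rewrite ltcR.
have [y [Sy]] := cx _ (nbhsx_ballx x _ e0').
by rewrite -ball_normE /= -rnormE ltcR; exists y.
Qed.

End RealNorm.

(* Needed because the contraction principle and the uniform boundedness theorem
   are available over real scalars only. *)
Definition realif {R : realType} (V : completeNormedModType R[i]) : Type := V.

Section Realification.
Context {R : realType} (V : completeNormedModType R[i]).
Local Open Scope complex_scope.

HB.instance Definition _ := GRing.Zmodule.copy (realif V) V.

Definition realif_scale (r : R) (x : realif V) : realif V := (r%:C *: (x : V)).

Lemma realif_scaleA (r s : R) x : realif_scale r (realif_scale s x) = realif_scale (r * s) x.
Proof. by rewrite /realif_scale scalerA rmorphM. Qed.

Lemma realif_scale1 : left_id 1 realif_scale.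
Proof. by move=> x; rewrite /realif_scale rmorph1 scale1r. Qed.

Lemma realif_scaleDr : right_distributive realif_scale +%R.
Proof. by move=> r x y; exact: scalerDr. Qed.

Lemma realif_scaleDl x : {morph realif_scale^~ x : r s / r + s}.
Proof. by move=> r s; rewrite /realif_scale rmorphD; exact: scalerDl. Qed.

HB.instance Definition _ := GRing.Zmodule_isLmodule.Build R (realif V)
  realif_scaleA realif_scale1 realif_scaleDr realif_scaleDl.

Definition realif_norm (x : realif V) : R := rnorm (x : V).

HB.instance Definition _ := Lmodule_isNormed.Build R (realif V)
  (@rnormD R V : forall x y : realif V, realif_norm (x + y) <= realif_norm x + realif_norm y)
  (@rnormZ R V : forall r (x : realif V), realif_norm (r *: x) = `|r| * realif_norm x)
  (@rnorm_eq0 R V : forall x : realif V, realif_norm x = 0 -> x = 0).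

Lemma realif_complete (F : set_system (realif V)) :
  ProperFilter F -> cauchy F -> cvg F.
Proof.
move=> FF /cauchy_ballP Fc.
have Gc : cauchy (F : set_system V).
  apply/cauchy_ballP => e /normc_gt0P[r r0 ->].
  have [[A B] /= [FA FB] AB] := Fc _ r0; exists (A, B) => // -[x y] /= xy.
  by have := AB (x, y) xy; rewrite -!ball_normE /= -rnormE ltcR.
have /cvg_ex[/= l Fl] : cvg (F : set_system V) by exact: cauchy_cvg.
apply/cvg_ex; exists (l : realif V); apply/cvgrPdist_lt => e e0.
have e0' : 0 < e%:C :> R[i] by rewrite ltcR.
have /cvgrPdist_lt/(_ _ e0') := Fl.
by apply: filterS => x /=; rewrite -rnormE ltcR.
Qed.

HB.instance Definition _ := Uniform_isComplete.Build (realif V) realif_complete.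

End Realification.

Lemma realif_normE {R : realType} (V : completeNormedModType R[i]) (x : V) :
  `|x : realif V| = rnorm x.
Proof. by []. Qed.

(** * Nearest points and orthogonal decomposition *)

Section ProjectionTheorem.
Context {R : realType} {H : hilbertType R}.
Implicit Types x y z : H.
Local Open Scope complex_scope.

Lemma rnorm_sqD x y : rnorm (x + y) ^+ 2 = rnorm x ^+ 2 + 2 * rinner x y + rnorm y ^+ 2.
Proof. by rewrite -!rinner_self rinnerDl !rinnerDr (rinnerC y x); ring. Qed.

Lemma rnorm_sqB x y : rnorm (x - y) ^+ 2 = rnorm x ^+ 2 - 2 * rinner x y + rnorm y ^+ 2.
Proof. by rewrite -!rinner_self rinnerBl !rinnerBr (rinnerC y x); ring. Qed.

Lemma parallelogram x y :
  rnorm (x + y) ^+ 2 + rnorm (x - y) ^+ 2 = 2 * (rnorm x ^+ 2 + rnorm y ^+ 2).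
Proof. by rewrite rnorm_sqD rnorm_sqB; ring. Qed.

Lemma nearest_point (S : csubspace H) x : exists2 y, csub_set S y &
  forall z, csub_set S z -> rnorm (x - y) <= rnorm (x - z).
Proof.
have [S0 SL Sc] := csub_closed_linear S.
pose D := [set rnorm (x - z) ^+ 2 | z in csub_set S].
have Dinf : has_inf D.
  split; first by exists (rnorm (x - 0) ^+ 2), 0.
  by exists 0 => _ [z _ <-]; exact: sqr_ge0.
pose d := inf D.
have dle z : csub_set S z -> d <= rnorm (x - z) ^+ 2.
  by move=> Sz; apply: ge_inf; [exact: Dinf.2|exists z].
have ex n : exists z, csub_set S z /\ rnorm (x - z) ^+ 2 < d + n.+1%:R^-1.
  have n0 : 0 < n.+1%:R^-1 :> R by rewrite invr_gt0.
  by have [_ [z Sz <-] zd] := inf_adherent n0 Dinf; exists z.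
have [u uP] := choice ex.
(* The midpoint [w] of [z] and [z'] lies in [S], hence at squared distance at least [d] from [x];
   the parallelogram law then bounds the distance of two almost minimizing points. *)
have Scv z z' : csub_set S z -> csub_set S z' ->
    rnorm (z - z') ^+ 2 <= 2 * (rnorm (x - z) ^+ 2 - d) + 2 * (rnorm (x - z') ^+ 2 - d).
  move=> Sz Sz'; have := parallelogram (x - z) (x - z').
  have -> : x - z - (x - z') = z' - z by rewrite opprB addrC addrA subrK.
  pose w := (2^-1)%:C *: z + (2^-1)%:C *: z'.
  have Sw : csub_set S w by apply: (SL) => //; rewrite -[_ *: z']addr0; exact: SL.
  have -> : x - z + (x - z') = 2%:C *: (x - w).
    rewrite scalerBr scalerDr !scalerA -rmorphM /= divff// rmorph1 !scale1r.
    have -> : 2%:C *: x = x + x by rewrite -[2]/(1 + 1) rmorphD rmorph1 scalerDl scale1r.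
    by rewrite opprD addrACA.
  rewrite rnormZ exprMn (ger0_norm (ler0n _ 2)) (rdistC z z').
  by have := dle w Sw; move: (rnorm _ ^+ 2) => a; move: (rnorm _ ^+ 2) => b; lra.
have uc : cauchy ((u : nat -> realif H) n @[n --> \oo]).
  (* By [Scv] the squared distance of [u N] and [u n] is below [2 / N.+1 + 2 / n.+1], hence below
     [4 / N.+1] for [n >= N]. *)
  apply: cauchy_exP => e e0; have e20 : 0 < e ^+ 2 / 4 by rewrite divr_gt0// exprn_gt0.
  have [N _ /(_ N (leqnn N)) /= N1] := near_infty_natSinv_lt (PosNum e20).
  exists (u N); exists N => // n /= Nn.
  rewrite -ball_normE /= realif_normE -(@ltr_pXn2r _ 2)// ?nnegrE ?rnorm_ge0 ?ltW//.
  apply: le_lt_trans (Scv _ _ (uP N).1 (uP n).1) _.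
  have := (uP N).2; have := (uP n).2.
  have : n.+1%:R^-1 <= N.+1%:R^-1 :> R by rewrite lef_pV2 ?posrE// ler_nat.
  move: N1; move: (N.+1%:R^-1) (n.+1%:R^-1) (e ^+ 2).
  move: (rnorm (x - u n) ^+ 2) (rnorm (x - u N) ^+ 2).
  by move=> a b c p q; lra.
have /cvg_ex[/= l ul] : cvg ((u : nat -> realif H) n @[n --> \oo]) by exact: cauchy_cvg.
have un (e : R) : 0 < e -> exists n, rnorm (l - u n) < e /\ n.+1%:R^-1 < e.
  move=> e0; have ue : \forall n \near \oo, `|(l : realif H) - u n| < e.
    by move: e0; exact: (@cvgrPdist_lt R (realif H) _ \oo _ (u : nat -> realif H) l).1 ul e.
  near \oo => n; exists n; split; first by near: n.
  by near: n; exact: (near_infty_natSinv_lt (PosNum e0)).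
exists l.
  apply: (closed_rnormP _).1 Sc _ _ => e e0; have [n [ln _]] := un e e0.
  by exists (u n) => //; exact: (uP n).1.
move=> z Sz; apply/ler_addgt0Pr => e e0.
(* One bound controls the distance from [u n] to the limit, the other the excess in squared
   distance, absorbed by [a^2 + (e/2)^2 <= (a + e/2)^2]. *)
pose c := Num.min (e / 2) ((e / 2) ^+ 2).
have e20 : 0 < e / 2 by rewrite divr_gt0.
have c0 : 0 < c by rewrite lt_min e20 exprn_gt0.
have [n [ln nn]] := un c c0.
have : rnorm (x - l) <= rnorm (x - u n) + rnorm (l - u n).
  by rewrite (rdistC l); apply: le_trans (rnormD _ _); rewrite addrA subrK.
have : rnorm (x - u n) <= rnorm (x - z) + e / 2.
  rewrite -(@ler_pXn2r _ 2)// ?nnegrE ?addr_ge0 ?rnorm_ge0 ?(ltW e20)//.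
  apply: le_trans (ltW (uP n).2) _; have := dle z Sz.
  have : n.+1%:R^-1 <= (e / 2) ^+ 2 by rewrite ltW// (lt_le_trans nn)// ge_min lexx orbT.
  have := rnorm_ge0 (x - z); rewrite sqrrD; move: (rnorm (x - z)) => a a0.
  have : 0 <= a * (e / 2) *+ 2 by rewrite mulrn_wge0// mulr_ge0// ltW.
  move: (a * (e / 2) *+ 2) (n.+1%:R^-1) (a ^+ 2) ((e / 2) ^+ 2) => p q r t.
  by lra.
have : c <= e / 2 by rewrite ge_min lexx.
by lra.
Unshelve. all: by end_near. Qed.

Lemma orthogonal_decomposition (S : csubspace H) x : exists2 y, csub_set S y &
  forall z, csub_set S z -> inner z (x - y) = 0.
Proof.
have [S0 SL Sc] := csub_closed_linear S.
have [y Sy yP] := nearest_point S x; exists y => //.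
have SZ a z : csub_set S z -> csub_set S (a *: z).
  by move=> Sz; rewrite -[_ *: z]addr0; exact: SL.
(* Real parts suffice: [S] is stable under multiplication by ['i], which recovers the imaginary
   part. *)
suff r0 z : csub_set S z -> rinner z (x - y) = 0.
  move=> z Sz; rewrite inner_conj inner_rinner !(rinnerC (x - y)) !r0//; last exact: SZ.
  by rewrite rmorph0.
move=> Sz; set w := x - y.
have tP (t : R) : 2 * t * rinner z w <= t ^+ 2 * rnorm z ^+ 2.
  have Syz : csub_set S (t%:C *: z + y) by exact: SL.
  have : rnorm w ^+ 2 <= rnorm (w - t%:C *: z) ^+ 2.
    rewrite ler_pXn2r ?nnegrE ?rnorm_ge0//; apply: le_trans (yP _ Syz) _.
    by rewrite opprD addrA addrAC.
  rewrite rnorm_sqB rinnerZr rnormZ (rinnerC w) exprMn -normrX ger0_norm ?sqr_ge0//.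
  by move: (rnorm z ^+ 2) (rnorm w ^+ 2) => a b; lra.
have [z0|z0] := eqVneq (rnorm z) 0.
  by rewrite (rnorm_eq0 z0) /rinner inner0l.
have zz : 0 < rnorm z ^+ 2 by rewrite exprn_gt0// lt_def z0 rnorm_ge0.
(* The step length minimizing the distance along [z]; with it [tP] forces the square of [rinner z w]
   to be nonpositive. *)
set t := rinner z w / rnorm z ^+ 2.
have ta : t * rnorm z ^+ 2 = rinner z w by rewrite divfK// gt_eqF.
have tb : t * rinner z w <= 0.
  by have := tP t; rewrite expr2 -(mulrA t t) ta; lra.
apply/eqP; rewrite -sqrf_eq0 eq_le sqr_ge0 andbT expr2 -{1}ta mulrAC.
by rewrite mulr_le0_ge0// ltW.
Qed.

End ProjectionTheorem.

(** * Bounded operators and the open set of invertible ones *)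

Section BoundedOperators.
Context {R : realType} {H : normedModType R[i]}.
Implicit Types S T : bop H.

Lemma bop_norm_le T (M : R) : 0 <= M ->
  (forall x, rnorm (T x) <= M * rnorm x) -> `|T| <= M.
Proof.
move=> M0 TM; apply: (@opnorm_le _ _ _ _ (real_complex R)); first exact: rnormZ.
by move=> x x1; apply: le_trans (TM x) _; rewrite ler_piMr.
Qed.

Lemma bop_mul_bilinear : bounded_bilinear (fun S T : bop H => S * T).
Proof.
split=> [T a S S'|S a T T'|].
- by apply: bopP => x.
- by apply: bopP => x /=; rewrite bopD bopZ.
exists 1 => // S T; rewrite mul1r; apply: bop_norm_le => [|x]; first by rewrite mulr_ge0.
apply: le_trans (bop_normP S _) _; rewrite -mulrA ler_wpM2l//.
exact: bop_normP.
Qed.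

Lemma bop_scalerAl (r : R) S T : (r *: S) * T = r *: (S * T).
Proof. exact: (bbilZl bop_mul_bilinear). Qed.

Lemma bop_scalerAr (r : R) S T : S * (r *: T) = r *: (S * T).
Proof. exact: (bbilZr bop_mul_bilinear). Qed.

Definition bop_inverses T S := T * S = 1 /\ S * T = 1.

Definition invertible T := exists S, bop_inverses T S.

Definition binv T : bop H := get [set S | bop_inverses T S].

Lemma invertibleP T : invertible T -> bop_inverses T (binv T).
Proof. by move=> [S TS]; exact: (@getPex _ [set S | bop_inverses T S] (ex_intro _ S TS)). Qed.

Lemma mulrbV T : invertible T -> T * binv T = 1. Proof. by move=> /invertibleP[]. Qed.

Lemma mulVrb T : invertible T -> binv T * T = 1. Proof. by move=> /invertibleP[]. Qed.

Lemma bop_inverses_uniq T S S' : T * S = 1 -> S' * T = 1 -> S = S'.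
Proof. by move=> TS ST; rewrite -[S]mul1r -ST -mulrA TS mulr1. Qed.

Lemma binv_eq T S : T * S = 1 -> S * T = 1 -> binv T = S.
Proof.
move=> TS ST; have iT : invertible T by exists S.
by apply: (bop_inverses_uniq (mulrbV iT)).
Qed.

Lemma invertibleM S T : invertible S -> invertible T -> invertible (S * T).
Proof.
move=> [S' [SS' S'S]] [T' [TT' T'T]]; exists (T' * S'); split.
  by rewrite mulrA -(mulrA S) TT' mulr1 SS'.
by rewrite mulrA -(mulrA T') S'S mulr1 T'T.
Qed.

Lemma invertible_binv T : invertible T -> invertible (binv T).
Proof. by move=> /invertibleP[TS ST]; exists T; split. Qed.

Lemma invertibleZ (r : R) T : r != 0 -> invertible T -> invertible (r *: T).
Proof.
move=> r0 [S [TS ST]]; exists (r^-1 *: S).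
by split; rewrite bop_scalerAl bop_scalerAr scalerA ?TS ?ST ?divff ?mulVf// scale1r.
Qed.

Lemma bounded_below_invertible T (M : R) : 0 <= M ->
  (forall y, exists x, T x = y) -> (forall x, rnorm x <= M * rnorm (T x)) ->
  invertible T.
Proof.
move=> M0 /choice[S TS] TM.
have Tinj x y : T x = T y -> x = y.
  move=> xy; apply/eqP; rewrite -subr_eq0; apply/eqP/rnorm_eq0/eqP.
  rewrite eq_le rnorm_ge0 andbT; apply: le_trans (TM _) _.
  by rewrite bopB xy subrr rnorm0 mulr0.
have Sl : linear S by move=> a u v; apply: Tinj; rewrite bop_linear !TS.
have Sb : op_bounded (@rnorm R H) (@rnorm R H) S.
  by exists M => x; rewrite -{2}(TS x).
exists (BOp Sl Sb); split; apply: bopP => x /=; first exact: TS.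
by apply: Tinj; rewrite TS.
Qed.

End BoundedOperators.

Section InvertibleOpen.
Context {R : realType} {H : completeNormedModType R[i]}.
Local Open Scope complex_scope.

(** The map [x |-> y - T x] is a contraction; its fixed point takes the place of the Neumann
    series. *)
Lemma perturbed_equation (T : bop H) (q : R) (y : H) : 0 <= q -> q < 1 ->
  (forall x, rnorm (T x) <= q * rnorm x) -> exists x, x = y - T x.
Proof.
move=> q0 q1 Tq.
pose f (x : realif H) : realif H := y - T x.
have fS : set_fun [set: realif H] [set: realif H] f by [].
pose F : {fun [set: realif H] >-> [set: realif H]} := HB.pack f (isFun.Build _ _ _ _ f fS).
have Fc : is_contraction F.
  exists (NngNum q0); split => //= -[u v] _ /=; rewrite !realif_normE /=.
  have -> : F u - F v = - T (u - v :> H) :> H.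
    by rewrite bopB /= /f opprB addrC addrA subrK opprB.
  by rewrite rnormN.
have [|x _ xE] := banach_fixed_point Fc closedT; first by exists 0.
by exists x.
Qed.

Lemma invertible_near (T T' : bop H) S : bop_inverses T S ->
  `|S| * `|T' - T| <= 2^-1 -> invertible T'.
Proof.
move=> [TS ST] d.
have TSx x : T (S x) = x by have := congr1 (fun U => bop_fun U x) TS.
have STx x : S (T x) = x by have := congr1 (fun U => bop_fun U x) ST.
have bd x : rnorm (S ((T' - T) x)) <= 2^-1 * rnorm x.
  apply: le_trans (bop_normP _ _) _; apply: (@le_trans _ _ (`|S| * (`|T' - T| * rnorm x))).
    by rewrite ler_wpM2l// bop_normP.
  by rewrite mulrA ler_wpM2r// rnorm_ge0.
apply: (@bounded_below_invertible _ _ T' (2 * `|S|)).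
- by rewrite mulr_ge0.
- move=> y.
  (* Since [S] inverts [T], the equation [T' x = y] reads [x = S y - S (T' - T) x]. *)
  have [||x|x xE] := @perturbed_equation (S * (T' - T)) 2^-1 (S y).
  + by rewrite invr_ge0.
  + by rewrite invf_lt1// ltr1n.
  + exact: bd.
  exists x; rewrite -[T' x](subrK (T x)) -bop_subE {2}xE bopB TSx.
  have -> : T ((S * (T' - T)) x) = (T' - T) x by exact: TSx.
  by rewrite addrC subrK.
- move=> x; have xE : x = S (T' x) - S ((T' - T) x).
    by rewrite -bopB bop_subE opprB addrC subrK STx.
  have h1 : rnorm x <= rnorm (S (T' x)) + rnorm (S ((T' - T) x)).
    by rewrite {1}xE; apply: le_trans (rnormD _ _) _; rewrite rnormN.
  have h2 := bd x; have h3 := bop_normP S (T' x).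
  by rewrite -mulrA; lra.
Qed.

Lemma open_invertible : open [set T : bop H | invertible T].
Proof.
rewrite openE => T [S TS]; apply/nbhs_ballP.
have c0 : 0 < `|S| + 1 by rewrite ltr_wpDl.
exists (2^-1 / (`|S| + 1)) => /=; first by rewrite divr_gt0// invr_gt0.
move=> T'; rewrite -ball_normE /= distrC ltr_pdivlMr// mulrC => TT'.
apply: (invertible_near TS); apply: le_trans (ltW TT').
by rewrite ler_wpM2r// lerDl.
Qed.

End InvertibleOpen.

(** * Riesz representation and adjoints *)

Section Adjoint.
Context {R : realType} {H : hilbertType R}.
Implicit Types S T : bop H.
Local Open Scope complex_scope.

Lemma riesz_representation (phi : H -> R[i]) (M : R) :
  linear_for *%R phi -> (forall x, `|phi x| <= (M * rnorm x)%:C) ->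
  exists y, forall x, phi x = inner x y.
Proof.
move=> phil phiM.
have phi0 : phi 0 = 0.
  by have := phil (-1) 0 0; rewrite scaler0 addr0 mulN1r addNr.
have phiD x y : phi (x + y) = phi x + phi y.
  by have := phil 1 x y; rewrite scale1r mul1r.
have phiZ a x : phi (a *: x) = a * phi x by have := phil a x 0; rewrite !addr0 phi0 addr0.
have [p0|] := pselect (forall x, phi x = 0).
  by exists 0 => x; rewrite p0 inner0r.
move=> /existsNP[x0 /eqP px0].
have Kcl : closed_linear [set x | phi x = 0].
  split=> // [a u v /= pu pv|]; first by rewrite phiD phiZ pu pv mulr0 addr0.
  apply/closed_rnormP => x xK; apply/eqP; rewrite -normr_le0; apply/ler_addgt0Pl => e.
  move=> /normc_gt0P[r r0 ->]; rewrite addr0.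
  have d0 : 0 < r / (`|M| + 1) by rewrite divr_gt0// ltr_wpDl.
  have [y /= py xy] := xK _ d0.
  have -> : phi x = phi (x - y) by rewrite phiD -scaleN1r phiZ py mulr0 addr0.
  apply: le_trans (phiM _) _; rewrite lecR.
  apply: (@le_trans _ _ ((`|M| + 1) * rnorm (x - y))).
    by rewrite ler_wpM2r ?rnorm_ge0//; have := ler_norm M; lra.
  by rewrite mulrC -ler_pdivlMr ?ltr_wpDl// ltW.
(* The component [e] of [x0] orthogonal to the kernel spans a complement of it, so the representing
   vector is a multiple of [e]; testing at [e] fixes the coefficient. *)
have [p /= pp pK] := orthogonal_decomposition (CSubspace Kcl) x0.
set e := x0 - p in pK.
have pe : phi e = phi x0 by rewrite phiD -scaleN1r phiZ pp mulr0 addr0.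
have ee : inner e e != 0.
  apply/negP => /eqP; rewrite inner_norm => /eqP; rewrite sqrf_eq0 normr_eq0 => /eqP e0.
  by move: px0; rewrite -pe e0 phi0 eqxx.
exists (Num.conj (phi e / inner e e) *: e) => x; rewrite innerZr conjCK.
have : inner (x - (phi x / phi e) *: e) e = 0.
  apply: pK => /=; rewrite phiD -scaleN1r phiZ mulN1r phiZ divfK ?subrr//.
  by rewrite pe.
rewrite innerBl innerZl => /eqP; rewrite subr_eq0 => /eqP ->.
have pe0 : phi e != 0 by rewrite pe.
by rewrite [RHS]mulrC -!mulrA (mulrCA (inner e e)) divff// mulr1 mulVf// mulr1.
Qed.

(** Builds an operator from its matrix coefficients: the adjoint, and later the average of
    [unitary_average], which is known only weakly. *)
Lemma bounded_form_representation (b : H -> H -> R[i]) (M : R) : 0 <= M ->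
  (forall y, linear_for *%R (b^~ y)) ->
  (forall x a y y', b x (a *: y + y') = Num.conj a * b x y + b x y') ->
  (forall x y, `|b x y| <= (M * (rnorm x * rnorm y))%:C) ->
  exists2 T : bop H, `|T| <= M & forall x y, b x y = inner x (T y).
Proof.
move=> M0 bl br bM.
have /choice[T TP] : forall y, exists z, forall x, b x y = inner x z.
  move=> y; apply: (@riesz_representation _ (M * rnorm y)); first exact: bl.
  by move=> x; apply: le_trans (bM _ _) _; rewrite lecR -mulrA (mulrC (rnorm y)).
have Tl : linear T.
  move=> a y y'; apply: inner_injr => x.
  by rewrite -TP br innerDr innerZr !TP.
have Tb y : rnorm (T y) <= M * rnorm y.
  have [T0|T0] := eqVneq (rnorm (T y)) 0; first by rewrite T0 mulr_ge0// rnorm_ge0.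
  have T0' : 0 < rnorm (T y) by rewrite lt_def T0 rnorm_ge0.
  rewrite -(ler_pM2l T0') -expr2 -rinner_self mulrCA.
  rewrite /rinner -TP -lecR; apply: le_trans (bM _ _).
  apply: le_trans (normc_ge_Re _); rewrite lecR; exact: ler_norm.
by exists (BOp Tl (ex_intro _ M Tb)) => //; exact: bop_norm_le.
Qed.

Lemma adj_exists T : exists S : bop H, forall x y, inner (T x) y = inner x (S y).
Proof.
have [||||S _ SP] := @bounded_form_representation (fun x y => inner (T x) y) `|T|.
- exact: normr_ge0.
- by move=> y a u v; rewrite bop_linear innerDl innerZl.
- by move=> x a u v; rewrite innerDr innerZr.
- move=> x y; apply: le_trans (inner_cauchy_schwarz _ _) _.
  by rewrite -!rnormE -rmorphM lecR mulrA ler_wpM2r ?rnorm_ge0// bop_normP.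
by exists S.
Qed.

Lemma adjP T x y : inner (T x) y = inner x (adj T y).
Proof.
exact: (@getPex _ [set S : bop H | forall x y, inner (T x) y = inner x (S y)]
  (adj_exists T)).
Qed.

Lemma adj_eq T S : (forall x y, inner (T x) y = inner x (S y)) -> adj T = S.
Proof.
by move=> TS; apply: bopP => y; apply: inner_injr => x; rewrite -adjP TS.
Qed.

Lemma adjP' T x y : inner (adj T x) y = inner x (T y).
Proof. by rewrite inner_conj -adjP -inner_conj. Qed.

Lemma adjK T : adj (adj T) = T.
Proof. by apply: adj_eq => x y; exact: adjP'. Qed.

Lemma adjD S T : adj (S + T) = adj S + adj T.
Proof. by apply: adj_eq => x y /=; rewrite innerDl innerDr !adjP. Qed.

Lemma adjZ (r : R) T : adj (r *: T) = r *: adj T.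
Proof. by apply: adj_eq => x y /=; rewrite innerZl innerZr conj_real adjP. Qed.

Lemma adjN T : adj (- T) = - adj T.
Proof. by rewrite -scaleN1r adjZ scaleN1r. Qed.

Lemma adjB S T : adj (S - T) = adj S - adj T.
Proof. by rewrite adjD adjN. Qed.

Lemma adjM S T : adj (S * T) = adj T * adj S.
Proof. by apply: adj_eq => x y /=; rewrite !adjP. Qed.

Lemma adj1 : adj 1 = 1 :> bop H.
Proof. exact: adj_eq. Qed.

Lemma adj_norm_le T : `|adj T| <= `|T|.
Proof.
apply: bop_norm_le => // y.
have [T0|T0] := eqVneq (rnorm (adj T y)) 0; first by rewrite T0 mulr_ge0// rnorm_ge0.
have T0' : 0 < rnorm (adj T y) by rewrite lt_def T0 rnorm_ge0.
rewrite -(ler_pM2l T0') -expr2 -rinner_self /rinner -adjP mulrCA.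
apply: le_trans (ler_norm _) _; apply: le_trans (rinner_le _ _) _.
by rewrite mulrA ler_wpM2r ?rnorm_ge0// bop_normP.
Qed.

Definition adj_clin : clin (bop H) (bop H).
Proof.
exists adj => [a S T|]; first by rewrite adjD adjZ.
by exists 1 => T; rewrite mul1r adj_norm_le.
Defined.

(* Hellinger-Toeplitz: the inverse is symmetric and everywhere defined. *)
Lemma symmetric_bijective_invertible T :
  (forall x y, inner (T x) y = inner x (T y)) ->
  (forall x, T x = 0 -> x = 0) -> (forall y, exists x, T x = y) -> invertible T.
Proof.
move=> Ts Tinj Tsurj; have [S TS] := choice Tsurj.
have ST x : S (T x) = x.
  by apply/eqP; rewrite -subr_eq0; apply/eqP/Tinj; rewrite bopB TS subrr.
have Ss x y : rinner (S x) y = rinner x (S y).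
  by rewrite /rinner -{1}(TS y) -Ts TS.
(* By symmetry of [S] these functionals are bounded by [rnorm (S x)] at each [x]; the uniform bound,
   tested at the normalized [S y], bounds [S] on the unit ball. *)
pose F : set (realif H -> R^o) :=
  [set f | exists2 y, rnorm y <= 1 & f = (fun x => rinner x (S y))].
have [||M0 MP] := @Banach_Steinhauss R (realif H) R^o F _ _ 1.
- move=> _ [y y1 ->]; split.
    move=> r; exists (r * rnorm (S y)) => x xr.
    by apply: le_trans (rinner_le _ _) _; rewrite ler_wpM2r// rnorm_ge0.
  by move=> a u v; rewrite rinnerDl rinnerZl.
- move=> x; exists (rnorm (S x)) => _ [y y1 ->].
  rewrite -Ss; apply: le_trans (rinner_le _ _) _.
  by rewrite ler_piMr// rnorm_ge0.
have Sb y : rnorm y <= 1 -> rnorm (S y) <= `|M0|.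
  move=> y1; have [S0|S0] := eqVneq (rnorm (S y)) 0; first by rewrite S0.
  have S0' : 0 < rnorm (S y) by rewrite lt_def S0 rnorm_ge0.
  have := MP (fun x => rinner x (S y)) (ex_intro2 _ _ y y1 erefl)
    ((rnorm (S y))^-1%:C *: S y).
  rewrite realif_normE rnormZ ger0_norm ?invr_ge0 ?rnorm_ge0// mulVf// => /(_ (lexx _)).
  rewrite rinnerZl rinner_self expr2 mulrA mulVf// mul1r => h.
  by apply: le_trans (ler_norm _) _; apply: le_trans h _; exact: ler_norm.
apply: (@bounded_below_invertible _ _ T `|M0|) => // x.
have [T0|T0] := eqVneq (rnorm (T x)) 0.
  by rewrite (Tinj _ (rnorm_eq0 T0)) rnorm0 mulr_ge0// rnorm_ge0.
have T0' : 0 < rnorm (T x) by rewrite lt_def T0 rnorm_ge0.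
rewrite -ler_pdivrMr// mulrC.
have := Sb ((rnorm (T x))^-1%:C *: T x).
rewrite rnormZ ger0_norm ?invr_ge0 ?rnorm_ge0// mulVf// => /(_ (lexx _)).
by rewrite -bopZ ST rnormZ ger0_norm// invr_ge0 rnorm_ge0.
Qed.

End Adjoint.

(** * Banach limits and averaging over the powers of a unitary *)

Section BanachLimit.
Context {R : realType}.
Implicit Types u v : nat -> R.

(** Compactness of the segment gives a cluster point, and a cluster point of an ultrafilter is a
    limit. *)
Lemma ultra_bounded_cvg (G : set_system nat) (GU : UltraFilter G) u (M : R) :
  (forall n, `|u n| <= M) -> cvg (u @ G).
Proof.
move=> uM; have GP : ProperFilter G by exact: ultra_proper.
have uG : (u @ G) [set` `[- M, M]].
  suff : \forall n \near G, u n \in `[- M, M] by [].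
  apply: nearW => n.
  by rewrite in_itv /= -ler_norml uM.
have [p [_ pc]] := @segment_compact R (- M) M (u @ G) _ uG.
apply/cvg_ex; exists p => B Bp.
have [//|nB] := in_ultra_setVsetC (u @^-1` B) GU.
by have [x [/= xnB xB]] := pc _ _ (nB : (u @ G) (~` B)) Bp.
Qed.

Definition seq_bounded u := exists M : R, forall n, `|u n| <= M.

Definition cesaro u n : R := (\sum_(k < n.+1) u k) / n.+1%:R.

Lemma cesaro_le u (M : R) n : (forall n, `|u n| <= M) -> `|cesaro u n| <= M.
Proof.
move=> uM; rewrite /cesaro normrM normfV (ger0_norm (ler0n _ n.+1)) ler_pdivrMr//.
apply: le_trans (ler_norm_sum _ _ _) _.
apply: (@le_trans _ _ (\sum_(k < n.+1) M)); first exact: ler_sum.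
by rewrite sumr_const card_ord mulr_natr.
Qed.

Record is_banach_limit (L : (nat -> R) -> R) : Prop := IsBanachLimit {
  blimD : forall u v, seq_bounded u -> seq_bounded v ->
    L (fun n => u n + v n) = L u + L v;
  blimZ : forall r u, seq_bounded u -> L (fun n => r * u n) = r * L u;
  blim_le : forall u M, (forall n, `|u n| <= M) -> `|L u| <= M;
  blimS : forall u, seq_bounded u -> L (fun n => u n.+1) = L u;
  blim_cst : forall c, L (fun=> c) = c }.

(* Limit of the Cesaro means along a non-principal ultrafilter. *)
Lemma banach_limit_exists : exists L, is_banach_limit L.
Proof.
have [G [GU oG]] := ultraFilterLemma (eventually_filter : ProperFilter \oo).
have GP : ProperFilter G by exact: ultra_proper.
have cvgG u : seq_bounded u -> cvg (cesaro u @ G).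
  by move=> [M uM]; apply: (@ultra_bounded_cvg G GU _ M) => n; exact: cesaro_le.
exists (fun u => lim (cesaro u @ G)); split.
- move=> u v ub vb.
  have -> : cesaro (fun n => u n + v n) = (fun n => cesaro u n + cesaro v n).
    by apply/funext => n; rewrite /cesaro big_split /= mulrDl.
  by apply/cvg_lim => //; apply: cvgD; exact: cvgG.
- move=> r u ub.
  have -> : cesaro (fun n => r * u n) = (fun n => r * cesaro u n).
    by apply/funext => n; rewrite /cesaro -mulr_sumr mulrA.
  by apply/cvg_lim => //; apply: cvgM; [exact: cvg_cst|exact: cvgG].
- move=> u M uM.
  have uc : cvg (cesaro u @ G) by apply: cvgG; exists M.
  apply: (@closed_cvg _ _ G _ (fun n => `|cesaro u n|) [set x | x <= M]).
  + exact: closed_le.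
  + by apply: nearW => n /=; exact: cesaro_le.
  + exact: cvg_norm.
- move=> u [M uM].
  (* A shift changes the mean by a telescoped term that tends to zero at infinity, hence also along
     the finer filter [G]. *)
  have -> : cesaro (fun n => u n.+1) = (fun n => cesaro u n + (u n.+1 - u 0) / n.+1%:R).
    apply/funext => n; rewrite /cesaro -mulrDl; congr (_ / _).
    have -> : \sum_(k < n.+1) u k.+1 = \sum_(k < n.+2) u k - u 0.
      by rewrite [in RHS]big_ord_recl /= addrC addKr; apply: eq_bigr => k _.
    by rewrite big_ord_recr /= addrA.
  apply/cvg_lim => //; rewrite -[lim _]addr0; apply: cvgD; first by apply: cvgG; exists M.
  have M0 : 0 <= M by apply: le_trans (uM 0%N).
  apply: (@cvg_trans _ ((fun n => (u n.+1 - u 0) / n.+1%:R) @ \oo)).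
    by apply: cvg_app => A; exact: oG.
  apply/cvgrPdist_le => e e0.
  have d0 : 0 < e / (2 * M + 1) by rewrite divr_gt0// ltr_wpDl// mulr_ge0.
  near=> n; rewrite sub0r normrN normrM normfV (ger0_norm (ler0n _ n.+1)).
  apply: (@le_trans _ _ ((2 * M + 1) * n.+1%:R^-1)).
    rewrite ler_wpM2r ?invr_ge0//; apply: le_trans (ler_normB _ _) _.
    by have := uM n.+1; have := uM 0; lra.
  rewrite mulrC -ler_pdivlMr ?ltr_wpDl ?mulr_ge0// ltW//.
  by near: n; exact: (near_infty_natSinv_lt (PosNum d0)).
- move=> c; have -> : cesaro (fun=> c) = fun=> c.
    apply/funext => n; rewrite /cesaro sumr_const card_ord -[c *+ _]mulr_natr mulfK//.
  by apply/cvg_lim => //; exact: cvg_cst.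
Unshelve. all: by end_near. Qed.

Local Open Scope complex_scope.

Definition cseq_bounded (w : nat -> R[i]) := exists M : R, forall n, `|w n| <= M%:C.

Definition clim (L : (nat -> R) -> R) (w : nat -> R[i]) : R[i] :=
  L (fun n => complex.Re (w n)) +i* L (fun n => complex.Im (w n)).

Lemma Re_le_norm (a : R[i]) (M : R) : `|a| <= M%:C -> `|complex.Re a| <= M.
Proof. by move=> aM; rewrite -lecR; apply: le_trans (normc_ge_Re _) aM. Qed.

Lemma normi : `|'i| = 1 :> R[i].
Proof. by rewrite normc_def /= expr0n expr1n add0r sqrtr1. Qed.

Lemma Im_le_norm (a : R[i]) (M : R) : `|a| <= M%:C -> `|complex.Im a| <= M.
Proof.
move=> aM; have := @Re_le_norm (- 'i * a) M.
rewrite normrM normrN normi mul1r.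
by case: a aM => x y aM /(_ aM) /=; rewrite oppr0 mul0r sub0r mulN1r opprK.
Qed.

Section ComplexLimit.
Context (L : (nat -> R) -> R) (Lb : is_banach_limit L).
Implicit Types w : nat -> R[i].

Let Reb w : cseq_bounded w -> seq_bounded (fun n => complex.Re (w n)).
Proof. by move=> [M wM]; exists M => n; exact: Re_le_norm. Qed.

Let Imb w : cseq_bounded w -> seq_bounded (fun n => complex.Im (w n)).
Proof. by move=> [M wM]; exists M => n; exact: Im_le_norm. Qed.

Lemma climD w w' : cseq_bounded w -> cseq_bounded w' ->
  clim L (fun n => w n + w' n) = clim L w + clim L w'.
Proof.
move=> wb wb'; apply/eqP; rewrite eq_complex /=; apply/andP; split; apply/eqP.
  rewrite -(blimD Lb); [|exact: Reb|exact: Reb].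
  by congr L; apply/funext => n; rewrite ReD.
rewrite -(blimD Lb); [|exact: Imb|exact: Imb].
by congr L; apply/funext => n; rewrite ImD.
Qed.

Let seq_boundedZ (r : R) (u : nat -> R) : seq_bounded u -> seq_bounded (fun n => r * u n).
Proof. by move=> [M uM]; exists (`|r| * M) => n; rewrite normrM ler_wpM2l. Qed.

Lemma climZ a w : cseq_bounded w -> clim L (fun n => a * w n) = a * clim L w.
Proof.
move=> wb; case: a => p q; apply/eqP; rewrite eq_complex /=; apply/andP; split; apply/eqP.
  rewrite -mulNr -(blimZ Lb _ (Reb wb)) -(blimZ Lb _ (Imb wb)) -(blimD Lb);
    [|exact/seq_boundedZ/Reb|exact/seq_boundedZ/Imb].
  by congr L; apply/funext => n; case: (w n) => x y /=; rewrite mulNr.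
rewrite -(blimZ Lb _ (Reb wb)) -(blimZ Lb _ (Imb wb)) -(blimD Lb);
  [|exact/seq_boundedZ/Imb|exact/seq_boundedZ/Reb].
by congr L; apply/funext => n; case: (w n) => x y /=.
Qed.

(** The factor [2] comes from estimating real and imaginary parts separately; continuity of the
    average needs no sharper constant. *)
Lemma clim_le w (M : R) : (forall n, `|w n| <= M%:C) -> `|clim L w| <= (2 * M)%:C.
Proof.
move=> wM; rewrite (complexE (clim L w)); apply: le_trans (ler_normD _ _) _.
rewrite normrM normi mul1r.
rewrite !norm_real_complex -rmorphD lecR /= mulr_natl mulr2n lerD//.
  by apply: (blim_le Lb) => n; exact: Re_le_norm.
by apply: (blim_le Lb) => n; exact: Im_le_norm.
Qed.

Lemma climS w : cseq_bounded w -> clim L (fun n => w n.+1) = clim L w.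
Proof.
by move=> wb; rewrite /clim (blimS Lb (Reb wb)) (blimS Lb (Imb wb)).
Qed.

Lemma clim_cst a : clim L (fun=> a) = a.
Proof. by case: a => p q; rewrite /clim /= !(blim_cst Lb). Qed.

End ComplexLimit.

End BanachLimit.

Section UnitaryAverage.
Context {R : realType} {H : hilbertType R}.
Implicit Types X Y : bop H.
Local Open Scope complex_scope.

Lemma unitary_rnorm (W : bop H) x : adj W * W = 1 -> rnorm (W x) = rnorm x.
Proof.
move=> WW; apply/eqP; rewrite -(@eqrXn2 _ 2)// ?rnorm_ge0// -!rinner_self /rinner adjP.
by have := congr1 (fun U => bop_fun U x) WW => /= ->.
Qed.

Lemma inner_le (x y : H) : `|inner x y| <= (rnorm x * rnorm y)%:C.
Proof. by rewrite rmorphM /= !rnormE; exact: inner_cauchy_schwarz. Qed.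

(* The conditional expectation onto the commutant of a unitary. *)
Lemma unitary_average (W : bop H) : unitary W -> exists Phi : clin (bop H) (bop H),
  (forall X, W * Phi X * adj W = Phi X) /\
  (forall X, W * X * adj W = X -> Phi X = X).
Proof.
move=> [WW' W'W]; have [L Lb] := @banach_limit_exists R.
pose th X := W * X * adj W.
have thn X n x : rnorm (iter n th X x) <= `|X| * rnorm x.
  elim: n x => [|n IHn] x; first exact: bop_normP.
  rewrite iterS /th /= unitary_rnorm//; apply: le_trans (IHn _) _.
  by rewrite unitary_rnorm// adjK.
pose b X x y := clim L (fun n => inner x (iter n th X y)).
have bd X x y n : `|inner x (iter n th X y)| <= (`|X| * (rnorm x * rnorm y))%:C.
  apply: le_trans (inner_le _ _) _; rewrite lecR mulrCA ler_wpM2l ?rnorm_ge0//.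
have bdd X x y : cseq_bounded (fun n => inner x (iter n th X y)).
  by exists (`|X| * (rnorm x * rnorm y)) => n; exact: bd.
have bddZ (a : R[i]) (w : nat -> R[i]) : cseq_bounded w -> cseq_bounded (fun n => a * w n).
  move=> [M wM]; exists (complex.Re `|a| * M) => n.
  have aE : (complex.Re `|a|)%:C = `|a| by rewrite RRe_real// normr_real.
  have -> : (complex.Re `|a| * M)%:C = `|a| * M%:C.
    by rewrite -[in RHS]aE; exact: (rmorphM (real_complex R)).
  by rewrite normrM ler_wpM2l.
have ex X : exists T : bop H, `|T| <= 2 * `|X| /\ forall x y, b X x y = inner x (T y).
  have [||||T TX TP] := @bounded_form_representation _ _ (b X) (2 * `|X|).
  - by rewrite mulr_ge0.
  - move=> y a u v; rewrite /b -(climZ Lb)// -(climD Lb)//; last exact: bddZ.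
    by congr clim; apply/funext => n; rewrite innerDl innerZl.
  - move=> x a u v; rewrite /b -(climZ Lb)// -(climD Lb)//; last exact: bddZ.
    by congr clim; apply/funext => n; rewrite bop_linear innerDr innerZr.
  - by move=> x y; rewrite -mulrA; apply: (clim_le Lb) => n; exact: bd.
  by exists T.
have [Phi PhiP] := choice ex.
have thL n (a : R) X Y : iter n th (a *: X + Y) = a *: iter n th X + iter n th Y.
  elim: n => [//|n IHn]; by rewrite !iterS IHn /th mulrDr mulrDl bop_scalerAr bop_scalerAl.
have Phil : linear Phi.
  move=> a X Y; apply: bopP => y; apply: inner_injr => x.
  rewrite -(PhiP _).2 /= innerDr innerZr conj_real -!(PhiP _).2 /b.
  rewrite -(climZ Lb)// -(climD Lb)//; last exact: bddZ.
  by congr clim; apply/funext => n; rewrite thL /= innerDr innerZr conj_real.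
have Phib : op_bounded (fun X : bop H => `|X|) (fun X : bop H => `|X|) Phi.
  by exists 2 => X; exact: (PhiP X).1.
exists (CLin Phil Phib) => /=; split=> X.
  (* Conjugation by [W] turns each iterate of [th] into the next one, so the claim is shift
     invariance of the Banach limit. *)
  apply: bopP => y; apply: inner_injr => x /=.
  rewrite -adjP' -!(PhiP _).2 /b -[RHS](climS Lb)//; congr clim; apply/funext => n.
  by rewrite adjP' iterS.
move=> XW; apply: bopP => y; apply: inner_injr => x; rewrite -(PhiP _).2 /b.
have -> : (fun n => inner x (iter n th X y)) = fun=> inner x (X y).
  apply/funext => n; suff -> : iter n th X = X by [].
  by elim: n => [//|n IHn]; rewrite iterS IHn.
exact: (clim_cst Lb).
Qed.

End UnitaryAverage.

Section Retraction.
Context {R : realType} {E : normedModType R}.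

(** A bounded retraction settles both closedness conditions: [S] is the kernel of [Pi - id], and the
    kernel of [Pi] is the complement. *)
Lemma retract_complemented (S : set E) (Pi : clin E E) :
  (forall x, S (Pi x)) -> (forall x, S x -> Pi x = x) -> complemented_in setT S.
Proof.
move=> PS SP.
have SE : S = [set x | (Pi + clin_opp E) x = 0].
  apply/seteqP; split=> x /=; first by move=> /SP ->; rewrite subrr.
  by move=> /eqP; rewrite subr_eq0 => /eqP <-.
split; [by rewrite SE; exact: clin_kernel_closed_linear|by []|].
exists [set x | Pi x = 0]; split; [exact: clin_kernel_closed_linear|by []| |].
  apply/seteqP; split=> x /=; first by move=> [/SP -> ->].
  by move=> ->; rewrite clin0; split => //; rewrite -(clin0 Pi).
move=> v _; exists (Pi v) => //; exists (v - Pi v); last by rewrite addrC subrK.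
by rewrite /= clinB (SP _ (PS v)) subrr.
Qed.

End Retraction.

(** * Noncommutative identities and the roots attached to projection pairs *)

Section OperatorAlgebra.
Context {R : realType} {H : hilbertType R}.
Implicit Types A E F N P Q S T X Y : bop H.

(* Real functionals separating operators: they reduce additive identities in
   the noncommutative ring [bop H] to linear arithmetic. *)
Definition bphi (x y : H) S : R := rinner x (S y).

Lemma bphiD x y S T : bphi x y (S + T) = bphi x y S + bphi x y T.
Proof. exact: rinnerDr. Qed.

Lemma bphiZ x y (r : R) S : bphi x y (r *: S) = r * bphi x y S.
Proof. exact: rinnerZr. Qed.

Lemma bphiN x y S : bphi x y (- S) = - bphi x y S.
Proof. by rewrite -scaleN1r bphiZ mulN1r. Qed.

Lemma bphi0 x y : bphi x y 0 = 0.
Proof. by rewrite -(scale0r 0) bphiZ mul0r. Qed.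

Lemma bphi_ext S T : (forall x y, bphi x y S = bphi x y T) -> S = T.
Proof.
move=> ST; apply: bopP => y; apply/eqP; rewrite -subr_eq0; apply/eqP/rnorm_eq0/eqP.
by rewrite -sqrf_eq0 -rinner_self rinnerBr -!/(bphi _ _ _) ST subrr.
Qed.

Definition lmul_clin S : clin (bop H) (bop H) :=
  bbil_postcomp bop_mul_bilinear S (clin_id _).

Definition rmul_clin S : clin (bop H) (bop H) :=
  bbil_precomp bop_mul_bilinear (clin_id _) S.

End OperatorAlgebra.

Ltac bop_abel :=
  apply: bphi_ext => ? ?; rewrite ?(bphiD, bphiN, bphiZ, bphi0); lra.

Ltac bop_expand :=
  rewrite ?(mulrDl, mulrDr, mulrN, mulNr, mul1r, mulr1, mulr0, mul0r, bop_scalerAl,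
            bop_scalerAr, mulrA).

Section SymmetryRoots.
Context {R : realType} {H : hilbertType R}.
Implicit Types A E F N P Q S T X Y : bop H.

(* The operators [E = P + Q - 1] of the pairs [(P, Q)] with difference [A]. *)
Definition roots A : set (bop H) :=
  [set E | [/\ adj E = E, E * A = - (A * E) & E * E = 1 - A * A]].

(** [E + A = 2P - 1] and [E - A = 2Q - 1], so idempotence of [P] and [Q] says that both square to
    [1]; adding and subtracting the two equations gives those of [roots]. *)
Lemma projection_pairsP A P Q : projection_pairs A (P, Q) <->
  [/\ adj A = A, P - Q = A & roots A (P + Q - 1)].
Proof.
split=> [[/= [PP Pa] [QQ Qa] PQ]|[Aa PQ [Ea EA EE]]].
  have Aa : adj A = A by rewrite -PQ adjB Pa Qa.
  split => //; split; first by rewrite adjB adjD Pa Qa adj1.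
    by rewrite -PQ; bop_expand; rewrite PP QQ; bop_abel.
  by rewrite -PQ; bop_expand; rewrite PP QQ; bop_abel.
set E := P + Q - 1 in Ea EA EE.
have PE : P = 2^-1 *: (1 + E + A) by rewrite /E -PQ; bop_abel.
have QE : Q = 2^-1 *: (1 + E - A) by rewrite /E -PQ; bop_abel.
clearbody E.
split => //=; split.
- by rewrite PE; bop_expand; rewrite EE EA; bop_abel.
- by rewrite PE adjZ !adjD adj1 Ea Aa.
- by rewrite QE; bop_expand; rewrite EE EA; bop_abel.
- by rewrite QE adjZ adjB !adjD adj1 Ea Aa.
Qed.

(** The equations defining [roots A], linearized at [E]. *)
Definition root_tangent A E : set (bop H) :=
  [set X | [/\ adj X = X, X * A = - (A * X) & X * E = - (E * X)]].

Lemma sq_invertible S : invertible (S * S) -> invertible S.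
Proof.
move=> [T [ST TS]]; exists (S * T); split; first by rewrite mulrA.
have -> : S * T = T * S.
  by apply: (@bop_inverses_uniq _ _ S); rewrite ?mulrA// -mulrA.
by rewrite -mulrA.
Qed.

Lemma root_tangent_retraction A E : adj A = A -> roots A E ->
  exists Pi : clin (bop H) (bop H), (forall X, root_tangent A E (Pi X)) /\
    (forall X, root_tangent A E X -> Pi X = X).
Proof.
move=> Aa [Ea EA EE]; pose s := E + A; pose t := E - A.
have sE : s = E + A by []; have tE : t = E - A by [].
clearbody s t.
have ss : s * s = 1 by rewrite sE; bop_expand; rewrite EE EA; bop_abel.
have tt : t * t = 1 by rewrite tE; bop_expand; rewrite EE EA; bop_abel.
have sa : adj s = s by rewrite sE adjD Ea Aa.
have ta : adj t = t by rewrite tE adjB Ea Aa.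
have Wu : unitary (t * s).
  split; rewrite adjM sa ta mulrA.
    by rewrite -(mulrA t) ss mulr1 tt.
  by rewrite -(mulrA s) tt mulr1 ss.
have [Phi [PhiW PhiX]] := unitary_average Wu.
(* The projection onto the operators anticommuting with [s]. On the range of [Phi] conjugation by
   [s] and by [t] coincide ([sY] below), so it yields anticommutation with both. *)
pose half : clin (bop H) (bop H) :=
  2^-1 *: (clin_id _ + clin_comp (clin_opp _) (clin_comp (lmul_clin s) (rmul_clin s))).
pose Pi := clin_comp (2^-1 *: (clin_id _ + @adj_clin R H)) (clin_comp half Phi).
have halfE X : half X = 2^-1 *: (X - s * X * s) by rewrite /half /= mulrA.
have PiE X : Pi X = 2^-1 *: (half (Phi X) + adj (half (Phi X))) by [].
have anti K : s * K * s = - K -> t * K * t = - K ->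
    K * A = - (A * K) /\ K * E = - (E * K).
  move=> sK tK.
  have sK' : K * s = - (s * K).
    by rewrite -mulrN -sK !mulrA ss mul1r.
  have tK' : K * t = - (t * K).
    by rewrite -mulrN -tK !mulrA tt mul1r.
  move: sK' tK'; rewrite sE tE; bop_expand => h1 h2.
  split; apply: bphi_ext => x y.
    have := congr1 (bphi x y) h1; have := congr1 (bphi x y) h2.
    by rewrite !(bphiD, bphiN); lra.
  have := congr1 (bphi x y) h1; have := congr1 (bphi x y) h2.
  by rewrite !(bphiD, bphiN); lra.
exists Pi; split=> X.
  set Y := Phi X.
  have YW : t * s * Y * (s * t) = Y by rewrite -[RHS](PhiW X) adjM sa ta.
  have sY : s * Y * s = t * Y * t.
    by rewrite -[in RHS]YW !mulrA tt mul1r -!mulrA tt mulr1.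
  set Z := half Y.
  have ZE : Z = 2^-1 *: (Y - s * Y * s) by rewrite /Z halfE.
  have sZ : s * Z * s = - Z.
    rewrite ZE; bop_expand; rewrite ss mul1r -(mulrA _ s s) ss mulr1.
    by bop_abel.
  have tZ : t * Z * t = - Z.
    rewrite ZE; bop_expand; rewrite -sY -[in LHS](mulrA t s Y).
    have -> : t * (s * Y) * s * t = Y by rewrite -[RHS]YW !mulrA.
    by bop_abel.
  have Zs : s * adj Z * s = - adj Z by rewrite -adjN -sZ !adjM sa mulrA.
  have Zt : t * adj Z * t = - adj Z by rewrite -adjN -tZ !adjM ta mulrA.
  rewrite PiE -/Y -/Z; clearbody Z; set K := 2^-1 *: (Z + adj Z).
  have sK : s * K * s = - K by rewrite /K; bop_expand; rewrite sZ Zs; bop_abel.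
  have tK : t * K * t = - K by rewrite /K; bop_expand; rewrite tZ Zt; bop_abel.
  have [KA KE] := anti _ sK tK.
  by split => //; rewrite adjZ adjD adjK addrC.
move=> [Xa XA XE].
have sX : s * X * s = - X.
  have Xs : X * s = - (s * X) by rewrite sE; bop_expand; rewrite XA XE; bop_abel.
  by rewrite -mulrA Xs mulrN mulrA ss mul1r.
have tX : t * X * t = - X.
  have Xt : X * t = - (t * X) by rewrite tE; bop_expand; rewrite XA XE; bop_abel.
  by rewrite -mulrA Xt mulrN mulrA tt mul1r.
(* Anticommuting with [s] and with [t], [X] commutes with [t * s]. *)
have PX : Phi X = X.
  apply: PhiX; rewrite adjM sa ta !mulrA -(mulrA t s X).
  by rewrite -(mulrA t (s * X)) sX mulrN mulNr tX opprK.
rewrite PiE PX halfE sX.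
have -> : 2^-1 *: (X - - X) = X by bop_abel.
by rewrite Xa; bop_abel.
Qed.

End SymmetryRoots.

(** * The Cayley transform between roots and tangent operators *)

Section CayleyChart.
Context {R : realType} {H : hilbertType R}.
Implicit Types A E F N P Q S T X Y : bop H.

Definition cayley E F : bop H := (F - E) * binv (F + E) * E.

Definition cayley_inv E X : bop H := (E + X) * binv (E - X) * E.

(** For [X = cayley E F] and [N = F + E], one has [E - X = 2 E N^-1 E] and [E + X = 2 F N^-1 E]; the
    first is invertible, and in the quotient all but [F] cancels. *)
Lemma cayleyK E F : invertible E -> invertible (F + E) ->
  invertible (E - cayley E F) /\ cayley_inv E (cayley E F) = F.
Proof.
move=> iE iN; rewrite /cayley_inv; set N := F + E.
have NN := mulrbV iN; have NN' := mulVrb iN; rewrite -/N in NN NN'.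
have EE := mulrbV iE; have EE' := mulVrb iE.
have E1 : E = N * binv N * E by rewrite NN mul1r.
have mE : E - cayley E F = 2 *: (E * binv N * E).
  rewrite {1}E1 /cayley -/N -!mulrA -mulrBl; set T := binv N * E.
  by rewrite /N; bop_expand; bop_abel.
have pE : E + cayley E F = 2 *: (F * binv N * E).
  rewrite {1}E1 /cayley -/N -!mulrA -mulrDl; set T := binv N * E.
  by rewrite /N; bop_expand; bop_abel.
have iM : invertible (E - cayley E F).
  rewrite mE; apply: invertibleZ; rewrite ?pnatr_eq0//.
  by apply: invertibleM => //; apply: invertibleM => //; exact: invertible_binv.
split => //.
have -> : binv (E - cayley E F) = 2^-1 *: (binv E * N * binv E).
  apply: binv_eq; rewrite mE bop_scalerAl bop_scalerAr scalerA.
    rewrite divff ?pnatr_eq0// scale1r !mulrA -(mulrA _ E) EE mulr1.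
    by rewrite -(mulrA _ (binv N)) NN' mulr1.
  rewrite mulVf ?pnatr_eq0// scale1r !mulrA -(mulrA _ (binv E)) EE' mulr1.
  by rewrite -(mulrA _ N) NN mulr1.
rewrite pE bop_scalerAl bop_scalerAr scalerA divff ?pnatr_eq0// scale1r.
by rewrite !mulrA -(mulrA _ E) EE mulr1 -(mulrA _ (binv N)) NN' mulr1 -mulrA EE' mulr1.
Qed.

Lemma cayley_invK E X : invertible E -> invertible (E - X) ->
  invertible (cayley_inv E X + E) /\ cayley E (cayley_inv E X) = X.
Proof.
move=> iE iN; rewrite /cayley; set N := E - X.
have NN := mulrbV iN; have NN' := mulVrb iN; rewrite -/N in NN NN'.
have EE := mulrbV iE; have EE' := mulVrb iE.
have E1 : E = N * binv N * E by rewrite NN mul1r.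
have pE : cayley_inv E X + E = 2 *: (E * binv N * E).
  rewrite {2}E1 /cayley_inv -/N -!mulrA -mulrDl; set T := binv N * E.
  by rewrite /N; bop_expand; bop_abel.
have mE : cayley_inv E X - E = 2 *: (X * binv N * E).
  rewrite {2}E1 /cayley_inv -/N -!mulrA -mulrBl; set T := binv N * E.
  by rewrite /N; bop_expand; bop_abel.
have iM : invertible (cayley_inv E X + E).
  rewrite pE; apply: invertibleZ; rewrite ?pnatr_eq0//.
  by apply: invertibleM => //; apply: invertibleM => //; exact: invertible_binv.
split => //.
have -> : binv (cayley_inv E X + E) = 2^-1 *: (binv E * N * binv E).
  apply: binv_eq; rewrite pE bop_scalerAl bop_scalerAr scalerA.
    rewrite divff ?pnatr_eq0// scale1r !mulrA -(mulrA _ E) EE mulr1.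
    by rewrite -(mulrA _ (binv N)) NN' mulr1.
  rewrite mulVf ?pnatr_eq0// scale1r !mulrA -(mulrA _ (binv E)) EE' mulr1.
  by rewrite -(mulrA _ N) NN mulr1.
rewrite mE bop_scalerAl bop_scalerAr scalerA divff ?pnatr_eq0// scale1r.
by rewrite !mulrA -(mulrA _ E) EE mulr1 -(mulrA _ (binv N)) NN' mulr1 -mulrA EE' mulr1.
Qed.

Lemma binv_intertwine N K S T : invertible N -> invertible K ->
  N * S = T * K -> binv N * T = S * binv K.
Proof.
move=> iN iK NS.
have -> : T = T * K * binv K by rewrite -mulrA (mulrbV iK) mulr1.
by rewrite -NS !mulrA (mulVrb iN) mul1r.
Qed.

Lemma binv_anticommute N S : invertible N -> N * S = - (S * N) ->
  binv N * S = - (S * binv N).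
Proof.
move=> iN NS; have := @binv_intertwine N N (- S) S iN iN.
by rewrite mulrN NS opprK => /(_ erefl) ->; rewrite mulNr.
Qed.

Lemma adj_binv N : invertible N -> adj (binv N) = binv (adj N).
Proof.
by move=> iN; apply/esym/binv_eq; rewrite -adjM ?(mulrbV iN) ?(mulVrb iN) adj1.
Qed.

(** Each factor contributes a sign. The transform has an odd number of factors thanks to its last
    factor [E]. *)
Lemma anticommute3 A S T X : S * A = - (A * S) -> T * A = - (A * T) ->
  X * A = - (A * X) -> S * T * X * A = - (A * (S * T * X)).
Proof.
move=> SA TA XA.
rewrite -(mulrA _ X) XA mulrN (mulrA _ A) -(mulrA S T) TA mulrN (mulrA S) SA.
by rewrite !(mulNr, mulrN) opprK !mulrA.
Qed.

(** As [E] and [F] have the same square, [N = F + E] intertwines them and anticommutes with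
    [D = F - E]. The three conditions follow by moving [N^-1] across. *)
Lemma cayley_tangent A E F : roots A E -> roots A F -> invertible (F + E) ->
  root_tangent A E (cayley E F).
Proof.
move=> [Ea EA EE] [Fa FA FF] iN; set N := F + E in iN *; pose D := F - E.
have NE : N * E = F * N by rewrite /N; bop_expand; rewrite EE FF; bop_abel.
have NF : N * F = E * N by rewrite /N; bop_expand; rewrite EE FF; bop_abel.
have EN : E * binv N = binv N * F by apply/esym/binv_intertwine.
have FN : F * binv N = binv N * E by apply/esym/binv_intertwine.
have ND : N * D = - (D * N).
  by rewrite /N /D; bop_expand; rewrite EE FF; bop_abel.
have DN := binv_anticommute iN ND.
have Na : adj N = N by rewrite adjD Fa Ea.
have Da : adj D = D by rewrite adjB Fa Ea.
have NA : N * A = - (A * N) by rewrite /N; bop_expand; rewrite EA FA; bop_abel.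
have NA' := binv_anticommute iN NA.
have DA : D * A = - (A * D) by rewrite /D; bop_expand; rewrite EA FA; bop_abel.
have DE : D * E = - (F * D) by rewrite /D; bop_expand; rewrite EE FF; bop_abel.
have ED : E * D = - (D * F) by rewrite /D; bop_expand; rewrite EE FF; bop_abel.
rewrite /cayley -/N -/D; split.
- rewrite !adjM adj_binv// Na Da Ea.
  have -> : D * binv N = - (binv N * D) by rewrite DN opprK.
  by rewrite mulNr -mulrA DE mulrN opprK !mulrA EN.
- exact: anticommute3.
- by rewrite !mulrA ED mulNr mulNr -(mulrA D F) FN !mulrA opprK.
Qed.

(** [E] intertwines [G = E - X] and [K = E + X], so the candidate is the conjugate [K E K^-1]. Its
    square is [1 - A * A] because [K], anticommuting with [A], commutes with [A * A]. *)
Lemma cayley_inv_root A E X : roots A E -> invertible E -> root_tangent A E X ->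
  invertible (E - X) -> roots A (cayley_inv E X).
Proof.
move=> [Ea EA EE] iE [Xa XA XE] iG; rewrite /cayley_inv; set G := E - X in iG *.
pose K := E + X.
have GE : G * E = E * K by rewrite /G /K; bop_expand; rewrite XE; bop_abel.
have KE : K * E = E * G by rewrite /G /K; bop_expand; rewrite XE; bop_abel.
have Ga : adj G = G by rewrite adjB Ea Xa.
have Ka : adj K = K by rewrite adjD Ea Xa.
have GA : G * A = - (A * G) by rewrite /G; bop_expand; rewrite EA XA; bop_abel.
have KA : K * A = - (A * K) by rewrite /K; bop_expand; rewrite EA XA; bop_abel.
have GA' := binv_anticommute iG GA.
have KK : K * K = G * G by rewrite /K /G; bop_expand; rewrite XE; bop_abel.
have iK : invertible K.
  have -> : K = E * G * binv E by rewrite -KE -mulrA (mulrbV iE) mulr1.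
  by apply: invertibleM; [exact: invertibleM|exact: invertible_binv].
have GEK : binv G * E = E * binv K by exact: binv_intertwine.
have GK : binv G * K = G * binv K by apply: binv_intertwine.
have FE : K * binv G * E = K * E * binv K by rewrite -mulrA GEK mulrA.
split.
- rewrite !adjM adj_binv// Ga Ka Ea GK mulrA -KE.
  by rewrite -mulrA -GEK mulrA.
- exact: anticommute3.
rewrite -/K FE !mulrA -(mulrA _ (binv K) K) (mulVrb iK) mulr1 -(mulrA K E E) EE.
have KC : K * (1 - A * A) = (1 - A * A) * K.
  rewrite mulrBr mulrBl mulr1 mul1r; congr (_ - _).
  by rewrite mulrA KA mulNr -mulrA KA mulrN opprK mulrA.
by rewrite KC -mulrA (mulrbV iK) mulr1.
Qed.

End CayleyChart.

(** * Smoothness of operator expressions and the submanifold chart *)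

Section OperatorCalculus.
Context {R : realType} {H : hilbertType R} {E : normedModType R} (U : set E).
Hypothesis Uopen : open U.
Implicit Types f g : E -> bop H.

Lemma Cn_mul n f g : Cn n U f -> Cn n U g -> Cn n U (fun x => f x * g x).
Proof. by move=> fC gC; apply: Cn_bbil => //; exact: bop_mul_bilinear. Qed.

Lemma Cn_adj n f : Cn n U f -> Cn n U (fun x => adj (f x)).
Proof. exact: (Cn_comp_clin Uopen (@adj_clin R H)). Qed.

Lemma Cn_binv n f : (forall x, U x -> invertible (f x)) ->
  Cn n U f -> Cn n U (fun x => binv (f x)).
Proof.
move=> fi; apply: (@Cn_inv _ _ _ Uopen _ (fun S T : bop H => S * T) 1).
- exact: bop_mul_bilinear.
- exact: mulrA.
- exact: mul1r.
- exact: mulr1.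
- by move=> x /fi; exact: mulrbV.
- by move=> x /fi; exact: mulVrb.
Qed.

Lemma Cn_scale n (F : normedModType R) (r : R) (f : E -> F) :
  Cn n U f -> Cn n U (fun x => r *: f x).
Proof. exact: (Cn_comp_clin Uopen (r *: clin_id F)). Qed.

Lemma Cn_fst n (F G : normedModType R) (f : E -> F * G) :
  Cn n U f -> Cn n U (fun x => (f x).1).
Proof. exact: (Cn_comp_clin Uopen (clin_fst F G)). Qed.

Lemma Cn_snd n (F G : normedModType R) (f : E -> F * G) :
  Cn n U f -> Cn n U (fun x => (f x).2).
Proof. exact: (Cn_comp_clin Uopen (clin_snd F G)). Qed.

End OperatorCalculus.

Lemma open_invertible_preimage {R : realType} {H : hilbertType R}
    {E : normedModType R} (f : E -> bop H) :
  Cn 0 setT f -> open [set x | invertible (f x)].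
Proof.
move=> fC; apply: (@open_comp _ _ f [set T | invertible T]); last exact: open_invertible.
by move=> x _; exact: fC.
Qed.

Section PairsSubmanifold.
Context {R : realType} {H : hilbertType R}.
Implicit Types A E F P Q S T X Y : bop H.

Lemma roots_invertible A E : invertible (1 - A * A) -> roots A E -> invertible E.
Proof. by move=> iC [_ _ EE]; apply: sq_invertible; rewrite EE. Qed.

Lemma pairs_submanifold A : invertible (1 - A * A) ->
  complemented_submanifold (projection_pairs A).
Proof.
move=> iC [P Q] /projection_pairsP[Aa PQ rE]; set E := P + Q - 1 in rE.
have iE := roots_invertible iC rE.
have [Pi [PiT TPi]] := root_tangent_retraction Aa rE.
pose O : set (bop H * bop H) := [set p | invertible (p.1 + p.2 - 1 + E)].
pose O' : set (bop H * bop H) := [set q | invertible (E - q.1)].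
(* The second coordinate measures how far the difference is from [A], which makes the chart defined
   on arbitrary pairs of operators near the center. *)
pose phi (p : bop H * bop H) := (cayley E (p.1 + p.2 - 1), p.1 - p.2 - A).
pose psi (q : bop H * bop H) :=
  (2^-1 *: (1 + cayley_inv E q.1 + (q.2 + A)), 2^-1 *: (1 + cayley_inv E q.1 - (q.2 + A))).
have psiE q : (psi q).1 + (psi q).2 - 1 = cayley_inv E q.1 by rewrite /psi /=; bop_abel.
have psiA q : (psi q).1 - (psi q).2 = q.2 + A by rewrite /psi /=; bop_abel.
have C1 n (U : set (bop H * bop H)) (Uo : open U) : Cn n U (fun p => p.1 + p.2 - 1).
  apply: Cn_sub => //; last exact: Cn_cst.
  by apply: Cn_add => //; [apply: Cn_fst|apply: Cn_snd] => //; exact: Cn_id.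
have Oo : open O.
  apply: open_invertible_preimage; apply: Cn_add; first exact: openT.
    by apply: C1; exact: openT.
  by apply: Cn_cst; exact: openT.
have Oo' : open O'.
  apply: open_invertible_preimage; apply: Cn_sub; [exact: openT| |].
    by apply: Cn_cst; exact: openT.
  by apply: Cn_fst; [exact: openT|apply: Cn_id; exact: openT].
have psiO q : O' q -> O (psi q) /\ phi (psi q) = q.
  move=> Oq; have [iF cK] := cayley_invK iE Oq.
  split; first by rewrite /O /= psiE.
  by rewrite /phi psiE psiA cK addrK; case: q {Oq iF cK}.
have phiO p : O p -> O' (phi p) /\ psi (phi p) = p.
  move=> Op; have [iX cK] := cayleyK iE Op; split => //.
  case: p Op iX cK => p1 p2 /= Op iX cK; rewrite /psi /phi /= cK.
  by congr (_, _); bop_abel.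
exists O, O', phi, psi, [set q | root_tangent A E q.1 /\ q.2 = 0]; split => //.
- rewrite /O /= -/E (_ : E + E = 2 *: E); last by bop_abel.
  by apply: invertibleZ; rewrite ?pnatr_eq0.
- move=> n; apply: Cn_pair => //; last first.
    apply: Cn_sub => //; last exact: Cn_cst.
    by apply: Cn_sub => //; [apply: Cn_fst|apply: Cn_snd] => //; exact: Cn_id.
  apply: Cn_mul => //; last exact: Cn_cst.
  apply: Cn_mul => //; first by apply: Cn_sub => //; [exact: C1|exact: Cn_cst].
  apply: Cn_binv => //; apply: Cn_add => //; [exact: C1|exact: Cn_cst].
- have C2 n : Cn n O' (fun q => cayley_inv E q.1).
    have C3 : Cn n O' (fun q => q.1) by apply: Cn_fst => //; exact: Cn_id.
    apply: Cn_mul => //; last exact: Cn_cst.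
    apply: Cn_mul => //; first by apply: Cn_add => //; exact: Cn_cst.
    by apply: Cn_binv => //; apply: Cn_sub => //; exact: Cn_cst.
  have C4 n : Cn n O' (fun q => q.2 + A).
    by apply: Cn_add => //; [apply: Cn_snd => //; exact: Cn_id|exact: Cn_cst].
  move=> n; apply: Cn_pair => //; apply: Cn_scale => //.
    by apply: Cn_add => //; apply: Cn_add => //; exact: Cn_cst.
  by apply: Cn_sub => //; apply: Cn_add => //; exact: Cn_cst.
- apply/seteqP; split=> [_ [p Op <-]|q /psiO[Oq qE]]; first exact: (phiO p Op).1.
  by exists (psi q).
- by move=> p /phiO[].
- apply: (@retract_complemented _ _ _
    (clin_comp (clin_inl _ _) (clin_comp Pi (clin_fst (bop H) (bop H))))).
    by move=> q; split => //; exact: PiT.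
  by move=> [q1 q2] /= [Tq ->]; rewrite TPi.
- apply/seteqP; split=> [_ [[p1 p2] [Op /projection_pairsP[_ pA rp]] <-]|q [Oq [Tq q2]]].
    split; first exact: (phiO _ Op).1.
    by split; [exact: cayley_tangent|rewrite /= pA subrr].
  have [Oq' qE] := psiO q Oq; exists (psi q) => //; split => //.
  rewrite (surjective_pairing (psi q)); apply/projection_pairsP.
  rewrite psiA q2 add0r psiE; split => //; exact: cayley_inv_root.
Qed.

End PairsSubmanifold.

(** * Velocities of curves and the tangent vectors of projection pairs *)

Section Curves.
Context {R : realType}.
Implicit Types E F G : normedModType R.

Lemma frechet_unique E F (f : E -> F) x l l' :
  frechet f x l -> frechet f x l' -> l = l'.
Proof. by move=> /frechet_fderiv <- /frechet_fderiv <-. Qed.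

Lemma frechet_chain E F G (c : E -> F) (g : F -> G) x c' g' :
  frechet c x c' -> frechet g (c x) g' -> frechet (fun t => g (c t)) x (clin_comp g' c').
Proof.
move=> /frechet_diff[dc cE] /frechet_diff[dg gE].
have dgc : differentiable (g \o c) x by exact: differentiable_comp.
have := differentiable_frechet dgc; congr (frechet _ _ _).
by apply: clinP => h; rewrite fderivE// diff_comp//= gE cE.
Qed.

Lemma curve_frechet E (c : R^o -> E) (I : set R^o) v :
  I 0 -> smooth_on I c -> 'd c 0 1 = v ->
  exists2 l : clin R^o E, frechet c 0 l & l 1 = v.
Proof.
move=> I0 cC <-; have [dc _] := cC 1%N.
exists (fderiv c 0); first exact/differentiable_frechet/dc.
by rewrite fderivE//; exact: dc.
Qed.

Lemma tangent_frechet E (M : set E) (c : R^o -> E) (I : set R^o) l :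
  open I -> I 0 -> smooth_on I c -> (forall t, I t -> M (c t)) -> frechet c 0 l ->
  tangent_space M (c 0) (l 1).
Proof.
move=> Io I0 cC cM /frechet_diff[_ cE]; exists c, I; split => //.
by rewrite cE.
Qed.

(** Serves to differentiate an identity that holds along a curve. *)
Lemma frechet_eq_on E F (U : set E) (f g : E -> F) x l l' : open U -> U x ->
  (forall y, U y -> f y = g y) -> frechet f x l -> frechet g x l' -> l = l'.
Proof.
move=> Uo Ux fg fl; apply: frechet_unique.
by apply: frechet_near fl; exact: (@open_near _ _ U Uo x (fun y => f y = g y)).
Qed.

Lemma smooth_frechet E F (U : set E) (f : E -> F) x : U x -> smooth_on U f ->
  frechet f x (fderiv f x).
Proof. by move=> Ux /(_ 1%N)[fd _]; apply: differentiable_frechet; exact: fd. Qed.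

Definition scalel_clin E (v : E) : clin R^o E.
Proof.
exists (fun s : R^o => s *: v) => [a s s'|]; first by rewrite scalerDl -scalerA.
by exists `|v| => s; rewrite normrZ mulrC.
Defined.

Lemma smooth_scalel E (v : E) (I : set R^o) : open I -> smooth_on I (fun s : R^o => s *: v).
Proof. by move=> Io n; exact: (Cn_clin Io n (scalel_clin v)). Qed.

End Curves.

Section PairsTangent.
Context {R : realType} {H : hilbertType R}.
Implicit Types A E F P Q S T X Y : bop H.

(** This upper bound on velocities is what surjectivity requires: [orbit_differential_surjective]
    finds a preimage using only these linear equations. *)
Lemma pairs_tangent_sub A P Q v : projection_pairs A (P, Q) ->
  tangent_space (projection_pairs A) (P, Q) v ->
  v.1 = v.2 /\ root_tangent A (P + Q - 1) v.1.
Proof.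
move=> pPQ [c [I [Io I0 cC cM [c0 cv]]]].
have [l cl lv] := curve_frechet I0 cC cv.
pose c1 t := (c t).1; pose c2 t := (c t).2.
have cE t : I t -> [/\ c1 t - c2 t = A & roots A (c1 t + c2 t - 1)].
  by move=> /cM; rewrite (surjective_pairing (c t)) => /projection_pairsP[].
have c1l : frechet c1 0 (clin_comp (clin_fst _ _) l).
  exact: (frechet_comp_clin (clin_fst _ _) cl).
have c2l : frechet c2 0 (clin_comp (clin_snd _ _) l).
  exact: (frechet_comp_clin (clin_snd _ _) cl).
pose e t := c1 t + c2 t - 1.
set l1 := clin_comp _ l in c1l; set l2 := clin_comp _ l in c2l.
have el : frechet e 0 (l1 + l2).
  rewrite -[l1 + l2]addr0; apply: frechet_add; [exact: frechet_add|exact: frechet_cst].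
have l12 : l1 1 + (- l2 1) = 0.
  have := frechet_add c1l (frechet_comp_clin (clin_opp _) c2l).
  move=> /(frechet_eq_on Io I0 (fun t It => (cE t It).1))/(_ (frechet_cst _ _)).
  by move=> /(congr1 (fun L : clin R^o (bop H) => L 1)).
have v12 : v.1 = v.2 by rewrite -lv; apply/eqP; rewrite -subr_eq0; apply/eqP.
split => //.
have e0 : e 0 = P + Q - 1 by rewrite /e /c1 /c2 c0.
have Lcst (L : clin (bop H) (bop H)) B : (forall t, I t -> L (e t) = B) -> L ((l1 + l2) 1) = 0.
  move=> LB; have := frechet_comp_clin L el.
  move=> /(frechet_eq_on Io I0 LB)/(_ (frechet_cst _ _)).
  by move=> /(congr1 (fun L : clin R^o (bop H) => L 1)).
have eE : (l1 + l2) 1 = 2 *: v.1.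
  by rewrite /= lv -v12; bop_abel.
have two X : 2 *: X = 0 -> X = 0.
  by move=> /eqP; rewrite scaler_eq0 pnatr_eq0 /= => /eqP.
split.
- apply/eqP; rewrite -subr_eq0; apply/eqP/two.
  have := Lcst (adj_clin + clin_opp _) 0; rewrite eE /= adjZ -scalerBr; apply.
  by move=> t /cE[_ [-> _ _]]; rewrite subrr.
- apply/eqP; rewrite -addr_eq0; apply/eqP/two.
  have := Lcst (rmul_clin A + lmul_clin A) 0.
  rewrite eE /= bop_scalerAl bop_scalerAr -scalerDr; apply.
  by move=> t /cE[_ [_ -> _]]; rewrite addNr.
- apply/eqP; rewrite -addr_eq0; apply/eqP/two.
  have d := frechet_bbil bop_mul_bilinear el el.
  have ee t : I t -> e t * e t = 1 - A * A by move=> /cE[_ []].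
  have /(congr1 (fun L : clin R^o (bop H) => L 1)) :=
    frechet_eq_on Io I0 ee d (frechet_cst (1 - A * A) 0).
  rewrite -[X in X = _]/(e 0 * (l1 + l2) 1 + (l1 + l2) 1 * e 0) eE e0.
  by rewrite bop_scalerAl bop_scalerAr -scalerDr addrC.
Qed.

End PairsTangent.

(** * The commutant as an algebra and the tangent spaces of its unitary group *)

Section CommutantAlgebra.
Context {R : realType} {H : hilbertType R} (A : bop H).
Implicit Types S T X Y Z : bop H.
Local Notation K := (csub (commutant A)).
Implicit Types u v w : K.

Definition in_commutant T (TA : T * A = A * T) : K :=
  CSub (introT (asboolP (csub_set (commutant A) T)) TA).

Lemma commutantP u : csub_val u * A = A * csub_val u.
Proof. exact: (csub_in u). Qed.

Definition commutant_val : clin K (bop H).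
Proof. by exists (@csub_val _ _ _) => //; exists 1 => x; rewrite mul1r. Defined.

Lemma commutant_mulP u v :
  csub_val u * csub_val v * A = A * (csub_val u * csub_val v).
Proof. by rewrite -mulrA commutantP mulrA commutantP mulrA. Qed.

(** Curves of unitaries must be smooth as maps into the type [K], so the product and inversion rules
    are applied inside [K]. *)
Definition commutant_mul u v : K := in_commutant (commutant_mulP u v).

Lemma commutant_mul_bilinear : bounded_bilinear commutant_mul.
Proof.
have bb := @bop_mul_bilinear R H.
split=> [v a u u'|u a v v'|].
- by apply: val_inj; exact: (bbil_linearl bb).
- by apply: val_inj; exact: (bbil_linearr bb).
by have [M M0 bM] := bbil_bounded bb; exists M => // u v; exact: bM.
Qed.

Definition commutant_one : K.
Proof. by apply: (@in_commutant 1); rewrite mul1r mulr1. Defined.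

Lemma unitary_commutant_adj u : unitary (csub_val u) ->
  adj (csub_val u) * A = A * adj (csub_val u).
Proof.
move=> [uu' u'u]; set a := adj _ in uu' u'u *.
rewrite -[RHS]mul1r -u'u -!mulrA (mulrA _ A) commutantP -mulrA.
by rewrite uu' mulr1.
Qed.

Lemma unitary_tangent_sub u v : unitary (csub_val u) ->
  tangent_space (commutant_unitary A) u v ->
  csub_val v * adj (csub_val u) + csub_val u * adj (csub_val v) = 0.
Proof.
move=> uu [c [I [Io I0 cC cM [c0 cv]]]].
have [l cl lv] := curve_frechet I0 cC cv.
have d1 := frechet_comp_clin commutant_val cl.
have d2 := frechet_comp_clin (@adj_clin R H) d1.
have d3 := frechet_bbil bop_mul_bilinear d1 d2.
have cc t : I t -> csub_val (c t) * adj (csub_val (c t)) = 1 by move=> /cM[].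
have /(congr1 (fun L : clin R^o (bop H) => L 1)) :=
  frechet_eq_on Io I0 cc d3 (frechet_cst (1 : bop H) 0).
by rewrite /= c0 lv addrC.
Qed.

(** The adjoint exchanges [1 + B] and [1 - B], which commute. *)
Lemma cayley_unitary (B S U : bop H) : adj B = - B -> unitary U ->
  bop_inverses (1 - B) S -> unitary ((1 + B) * S * U).
Proof.
move=> Ba [UU' U'U] [GS SG].
have Sa : bop_inverses (1 + B) (adj S).
  split; first by rewrite -[1 + B]adjK -adjM adjD adj1 Ba SG adj1.
  by rewrite -[1 + B]adjK -adjM adjD adj1 Ba GS adj1.
have [KS SK] := Sa.
have KG : (1 + B) * (1 - B) = (1 - B) * (1 + B) by bop_expand; bop_abel.
have KS' : (1 + B) * S = S * (1 + B).
  have <- : S * ((1 - B) * (1 + B)) * S = (1 + B) * S by rewrite mulrA SG mul1r.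
  by rewrite -KG -!mulrA GS mulr1.
split; rewrite !adjM adjD adj1 Ba.
  rewrite !mulrA -(mulrA _ U) UU' mulr1 KS' -(mulrA S) KS mulr1.
  by rewrite SG.
rewrite -!mulrA (mulrA (1 - B)) -KG -(mulrA (1 + B)) (mulrA (1 - B)) GS mul1r.
by rewrite (mulrA (adj S)) SK mul1r U'U.
Qed.

Lemma unitary_tangent_sup u v : unitary (csub_val u) ->
  csub_val v * adj (csub_val u) + csub_val u * adj (csub_val v) = 0 ->
  tangent_space (commutant_unitary A) u v.
Proof.
move=> uu vu; have [uu1 uu2] := uu; set U := csub_val u in vu uu uu1 uu2.
(* The curve is [(1 + t B) (1 - t B)^-1 U]; its velocity at [0] is [2 B U], hence the factor one
   half. *)
pose Z := csub_val v * adj U; pose B := 2^-1 *: Z.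
have Ba : adj B = - B.
  rewrite /B adjZ adjM adjK -scalerN; congr (_ *: _); apply/eqP.
  by rewrite -addr_eq0 addrC; apply/eqP.
have BA : B * A = A * B.
  rewrite /B bop_scalerAl bop_scalerAr; congr (_ *: _).
  by rewrite /Z -mulrA unitary_commutant_adj// mulrA commutantP mulrA.
pose b : K := in_commutant BA.
pose I : set R^o := [set t | invertible (1 - t *: B)].
have Io : open I.
  apply: open_invertible_preimage; apply: Cn_sub; [exact: openT| |].
    by apply: Cn_cst; exact: openT.
  by apply: smooth_scalel; exact: openT.
have I0 : I 0 by rewrite /I /= scale0r subr0; exists 1; split; rewrite mulr1.
pose f (t : R^o) : K := commutant_one - t *: b.
pose k (t : R^o) : K := commutant_one + t *: b.
(* The inverse lies again in the commutant; the value [0] off [I] only makes [g] total. *)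
have exg t : exists w : K, I t -> bop_inverses (1 - t *: B) (csub_val w).
  have [It|nIt] := pselect (I t); last by exists 0.
  have [GS SG] := invertibleP It.
  have SA : binv (1 - t *: B) * A = A * binv (1 - t *: B).
    apply: binv_intertwine => //; rewrite mulrBl mulrBr mul1r mulr1.
    by rewrite bop_scalerAl bop_scalerAr BA.
  by exists (in_commutant SA).
have [g gP] := choice exg.
have fC : smooth_on I f.
  by move=> n; apply: Cn_sub => //; [exact: Cn_cst|exact: smooth_scalel].
have kC : smooth_on I k.
  by move=> n; apply: Cn_add => //; [exact: Cn_cst|exact: smooth_scalel].
have gC : smooth_on I g.
  move=> n; apply: (@Cn_inv _ _ _ Io _ commutant_mul commutant_one _ _ _ _ f) => //.
  - exact: commutant_mul_bilinear.
  - by move=> x y z; apply: val_inj; exact: mulrA.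
  - by move=> x; apply: val_inj; exact: mul1r.
  - by move=> x; apply: val_inj; exact: mulr1.
  - by move=> t /gP[]; move=> h _; apply: val_inj.
  - by move=> t /gP[]; move=> _ h; apply: val_inj.
pose c (t : R^o) : K := commutant_mul (commutant_mul (k t) (g t)) u.
have cE t : csub_val (c t) = (1 + t *: B) * csub_val (g t) * U by [].
have cC : smooth_on I c.
  move=> n; apply: Cn_bbil => //; [exact: commutant_mul_bilinear| |exact: Cn_cst].
  by apply: Cn_bbil => //; exact: commutant_mul_bilinear.
have g0 : csub_val (g 0) = 1.
  have [_] := gP _ I0; by rewrite scale0r subr0 mulr1.
have c0 : c 0 = u by apply: val_inj; rewrite /= g0 scale0r addr0 !mul1r.
have cl := smooth_frechet I0 cC; set l := fderiv c 0 in cl.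
have l1 : l 1 = v.
  apply: val_inj => /=.
  have ml := frechet_clin (scalel_clin B) 0.
  (* The velocity is read off from this identity with the denominator cleared, which avoids
     differentiating the inverse. *)
  have eq t : I t -> csub_val (c t) * (adj U * (1 - t *: B)) = 1 + t *: B.
    move=> /gP[_ gt]; by rewrite cE -!mulrA (mulrA U) uu1 mul1r gt mulr1.
  have d1 : frechet (fun t : R^o => 1 - t *: B) 0 (0 + clin_comp (clin_opp _) (scalel_clin B)).
    by apply: frechet_add; [exact: frechet_cst|exact: (frechet_comp_clin (clin_opp _) ml)].
  have d2 := frechet_comp_clin (lmul_clin (adj U)) d1.
  have d0 := frechet_comp_clin commutant_val cl.
  have d3 := frechet_bbil bop_mul_bilinear d0 d2.
  have d4 : frechet (fun t : R^o => 1 + t *: B) 0 (0 + scalel_clin B).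
    by apply: frechet_add ml; exact: frechet_cst.
  have /(congr1 (fun L : clin R^o (bop H) => L 1)) := frechet_eq_on Io I0 eq d3 d4.
  rewrite /= !add0r scale1r g0 scale0r addr0 !mul1r subr0 mulr1 !mulrN mulrA uu1 mul1r => h.
  have lU : csub_val (l 1) * adj U = Z.
    by rewrite -[LHS](addKr (- B)) h /B; bop_abel.
  by rewrite -[LHS]mulr1 -uu2 mulrA lU /Z -mulrA uu2 mulr1.
rewrite -l1 -c0; apply: (tangent_frechet Io I0) => // t It.
suff : unitary (csub_val (c t)) by [].
rewrite cE; apply: cayley_unitary => //; last exact: gP.
by rewrite adjZ Ba scalerN.
Qed.

Lemma unitary_tangentE u : unitary (csub_val u) ->
  tangent_space (commutant_unitary A) u =
  [set v : K | csub_val v * adj (csub_val u) + csub_val u * adj (csub_val v) = 0].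
Proof.
move=> uu; apply/seteqP; split=> v; first exact: unitary_tangent_sub.
exact: unitary_tangent_sup.
Qed.

End CommutantAlgebra.

(** * The differential of the orbit map: image and kernel *)

Section OrbitSubmersion.
Context {R : realType} {H : hilbertType R} (A : bop H).
Hypothesis iC : invertible (1 - A * A).
Implicit Types P Q S T X Y Z : bop H.
Local Notation K := (csub (commutant A)).
Implicit Types u v w : K.

Lemma orbit_pairs P Q u : projection_pairs A (P, Q) -> commutant_unitary A u ->
  projection_pairs A (unitary_orbit P Q u).
Proof.
move=> [/= [PP Pa] [QQ Qa] PQ] [uu' u'u]; rewrite /unitary_orbit.
set a := csub_val u in uu' u'u *.
have proj S : S * S = S -> adj S = S -> orthogonal_projection (a * S * adj a).
  move=> SS Sa; split; last by rewrite !adjM adjK Sa mulrA.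
  by rewrite !mulrA -(mulrA _ (adj a)) u'u mulr1 -(mulrA a S S) SS.
split; [exact: proj|exact: proj|].
by rewrite /= -mulrBl -mulrBr PQ commutantP -mulrA uu' mulr1.
Qed.

Lemma orbit_smooth_curve (E : normedModType R) (I : set E) (c : E -> K) P Q :
  open I -> smooth_on I c -> smooth_on I (fun t => unitary_orbit P Q (c t)).
Proof.
move=> Io cC n.
have vC : Cn n I (fun t => csub_val (c t)) by exact: (Cn_comp_clin Io (commutant_val A)).
have aC : Cn n I (fun t => adj (csub_val (c t))) by exact: Cn_adj.
by apply: Cn_pair => //; apply: Cn_mul => //; apply: Cn_mul => //; exact: Cn_cst.
Qed.

Lemma orbit_frechet_curve (c : R^o -> K) l P Q : frechet c 0 l ->
  exists2 m : clin R^o (bop H * bop H)%type,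
    frechet (fun t => unitary_orbit P Q (c t)) 0 m &
    m 1 = (csub_val (l 1) * P * adj (csub_val (c 0)) +
             csub_val (c 0) * P * adj (csub_val (l 1)),
           csub_val (l 1) * Q * adj (csub_val (c 0)) +
             csub_val (c 0) * Q * adj (csub_val (l 1))).
Proof.
move=> cl; have d1 := frechet_comp_clin (commutant_val A) cl.
have d2 := frechet_comp_clin (@adj_clin R H) d1.
have dP := frechet_bbil bop_mul_bilinear (frechet_comp_clin (rmul_clin P) d1) d2.
have dQ := frechet_bbil bop_mul_bilinear (frechet_comp_clin (rmul_clin Q) d1) d2.
have d := frechet_add (frechet_comp_clin (clin_inl (bop H) (bop H)) dP)
                      (frechet_comp_clin (clin_inr (bop H) (bop H)) dQ).
move: d; set f := (X in frechet X); set m := (X in frechet _ _ X) => d.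
have <- : f = (fun t => unitary_orbit P Q (c t)).
  by apply/funext => t; congr (_, _) => /=; rewrite ?addr0 ?add0r.
exists m => //.
by congr (_, _) => /=; rewrite ?addr0 ?add0r [RHS]addrC.
Qed.

(** Along a curve of unitaries every extension [g] agrees with the orbit map, so its differential on
    a tangent vector is the velocity of the orbit. Substituting [v = Y u] turns that velocity into
    commutators. *)
Lemma orbit_differential P Q u v g : commutant_unitary A u ->
  projection_pairs A (P, Q) ->
  tangent_space (commutant_unitary A) u v ->
  smooth_extension (commutant_unitary A) (unitary_orbit P Q) u g ->
  let Y := csub_val v * adj (csub_val u) in
  let p := unitary_orbit P Q u in
  'd g u v = (Y * p.1 - p.1 * Y, Y * p.2 - p.2 * Y) /\
  tangent_space (projection_pairs A) p ('d g u v).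
Proof.
move=> uu pPQ tv [N [No Nu gC gf]].
have vu := unitary_tangent_sub uu tv; have [u1 u2] := uu.
move: tv => [c [I [Io I0 cC cM [c0 cv]]]] Y p.
have [l cl lv] := curve_frechet I0 cC cv.
have [m ml mE] := orbit_frechet_curve P Q cl.
have gl : frechet (fun t => g (c t)) 0 (clin_comp (fderiv g u) l).
  by apply: frechet_chain => //; rewrite c0; exact: (smooth_frechet Nu gC).
have gfc : \forall t \near (0 : R^o), g (c t) = unitary_orbit P Q (c t).
  have cO : \forall t \near (0 : R^o), N (c t).
    apply: (frechet_continuous cl); rewrite c0; exact: open_nbhs_nbhs.
  have nI : \forall t \near (0 : R^o), I t by exact: open_nbhs_nbhs.
  near=> t; apply: gf; first by near: t.
  by apply: cM; near: t.
have dE : 'd g u v = m 1.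
  have := frechet_unique (frechet_near gfc gl) ml.
  move=> /(congr1 (fun L : clin R^o (bop H * bop H)%type => L 1)) <- /=.
  by rewrite lv fderivE//; have [gd _] := gC 1%N; exact: gd.
have tgt : tangent_space (projection_pairs A) p ('d g u v).
  rewrite dE /p -c0; apply: (tangent_frechet Io I0 _ _ ml).
    exact: orbit_smooth_curve.
  by move=> t /cM; exact: orbit_pairs.
split => //.
have Ya : csub_val u * adj (csub_val v) = - Y.
  by apply/eqP; rewrite -addr_eq0 addrC; apply/eqP.
have E1 S : csub_val v * S * adj (csub_val u) = Y * (csub_val u * S * adj (csub_val u)).
  by rewrite /Y !mulrA -(mulrA _ (adj (csub_val u))) u2 mulr1.
have E2 S : csub_val u * S * adj (csub_val v) = - (csub_val u * S * adj (csub_val u) * Y).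
  by rewrite -mulrN -Ya !mulrA -(mulrA _ (adj (csub_val u))) u2 mulr1.
by rewrite dE mE c0 lv !E1 !E2.
Unshelve. all: by end_near. Qed.

Section OrbitPoint.
Context (P0 Q0 : bop H) (pPQ0 : projection_pairs A (P0, Q0)) (u : K).
Hypothesis uu : commutant_unitary A u.

Let U := csub_val u.
Let P := U * P0 * adj U.
Let Q := U * Q0 * adj U.
Let E := P + Q - 1.

Let pPQ : projection_pairs A (P, Q). Proof. exact: (orbit_pairs pPQ0 uu). Qed.

Let rE : roots A E. Proof. by have /projection_pairsP[] := pPQ. Qed.

Let PQ : P - Q = A. Proof. by have /projection_pairsP[] := pPQ. Qed.

Let iE : invertible E. Proof. exact: roots_invertible rE. Qed.

Let U1 : U * adj U = 1. Proof. by case: uu. Qed.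

Let U2 : adj U * U = 1. Proof. by case: uu. Qed.

Let PE : P = 2^-1 *: (1 + E + A). Proof. by rewrite /E -PQ; bop_abel. Qed.

Let QE : Q = 2^-1 *: (1 + E - A). Proof. by rewrite /E -PQ; bop_abel. Qed.

Lemma tangent_of_operator Y : Y * A = A * Y -> adj Y = - Y ->
  exists2 v : K, tangent_space (commutant_unitary A) u v &
    csub_val v = Y * U.
Proof.
move=> YA Ya.
have YUA : Y * U * A = A * (Y * U) by rewrite -mulrA commutantP mulrA YA mulrA.
exists (in_commutant YUA) => //; apply: unitary_tangent_sup => //=.
by rewrite -/U adjM Ya !mulrN !mulrA -(mulrA Y) U1 mulr1 mul1r subrr.
Qed.

Lemma operator_of_tangent v : tangent_space (commutant_unitary A) u v ->
  let Y := csub_val v * adj U in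
  [/\ Y * A = A * Y, adj Y = - Y & csub_val v = Y * U].
Proof.
move=> /(unitary_tangent_sub uu) vu Y; split.
- by rewrite -mulrA unitary_commutant_adj// mulrA commutantP mulrA.
- by rewrite adjM adjK; apply/eqP; rewrite -addr_eq0 addrC; apply/eqP.
- by rewrite -mulrA U2 mulr1.
Qed.

(** [P] and [Q] are half of [1 + E] plus or minus [A], and only [E] can fail to commute with [Y]. *)
Lemma commutator_root Y : Y * A = A * Y ->
  Y * P - P * Y = 2^-1 *: (Y * E - E * Y) /\ Y * Q - Q * Y = 2^-1 *: (Y * E - E * Y).
Proof.
move=> YA; split.
  by rewrite PE; bop_expand; rewrite YA; bop_abel.
by rewrite QE; bop_expand; rewrite YA; bop_abel.
Qed.

Lemma binv_root_anticommute : binv E * A = - (A * binv E).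
Proof. by case: rE => _ EA _; exact: binv_anticommute. Qed.

Lemma orbit_differential_surjective g :
  smooth_extension (commutant_unitary A) (unitary_orbit P0 Q0) u g ->
  'd g u @` tangent_space (commutant_unitary A) u =
  tangent_space (projection_pairs A) (unitary_orbit P0 Q0 u).
Proof.
move=> ge; apply/seteqP; split=> [_ [v tv <-]|[X X'] tX].
  exact: (orbit_differential uu pPQ0 tv ge).2.
have [/= XX' [Xa XA XE]] := pairs_tangent_sub pPQ tX; rewrite -/E in XE; subst X'.
have XE' : binv E * X = - (X * binv E).
  by apply: binv_anticommute => //; rewrite XE opprK.
have [Ea EA EE] := rE.
(* [Y * E = X] and [E * Y = - X], so half the commutator with [E] is [X]; two anticommutations with
   [A] make [Y] commute with [A]. *)
pose Y := X * binv E.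
have YA : Y * A = A * Y.
  by rewrite /Y -mulrA binv_root_anticommute mulrN !mulrA XA mulNr opprK.
have Ya : adj Y = - Y by rewrite /Y adjM adj_binv// Ea Xa XE'.
have [v tv vE] := tangent_of_operator YA Ya.
exists v => //; have [-> _] := orbit_differential uu pPQ0 tv ge.
have [_ _ vE'] := operator_of_tangent tv.
have -> : csub_val v * adj U = Y by rewrite vE -mulrA U1 mulr1.
have YE : Y * E = X by rewrite /Y -mulrA (mulVrb iE) mulr1.
have EY : E * Y = - X.
  have -> : E * Y = - (X * E) * binv E by rewrite XE opprK mulrA.
  by rewrite mulNr -mulrA (mulrbV iE) mulr1.
have [-> ->] := commutator_root YA.
by rewrite YE EY; congr (_, _); bop_abel.
Qed.

Lemma orbit_kernel_complemented g :
  smooth_extension (commutant_unitary A) (unitary_orbit P0 Q0) u g ->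
  complemented_in (tangent_space (commutant_unitary A) u)
    (tangent_space (commutant_unitary A) u `&` [set v | 'd g u v = 0]).
Proof.
move=> ge; set T := tangent_space _ u.
have TE : T = [set v | (clin_comp (rmul_clin (adj U)) (commutant_val A) +
    clin_comp (lmul_clin U) (clin_comp (@adj_clin R H) (commutant_val A)) : clin K _) v = 0].
  exact: unitary_tangentE.
have Tcl : closed_linear T by rewrite TE; exact: clin_kernel_closed_linear.
have dg : differentiable g u.
  by have [N [_ Nu gC _]] := ge; have [gd _] := gC 1%N; exact: gd.
(* Its vanishing says [Y * E = - (E * Y)]. Together with the kernel condition this gives
   [Y * E = 0], and [E] is invertible. *)
pose anti : clin K (bop H) :=
  clin_comp (rmul_clin E + lmul_clin E) (clin_comp (rmul_clin (adj U)) (commutant_val A)).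
have dgE v : T v -> let Y := csub_val v * adj U in
    'd g u v = (2^-1 *: (Y * E - E * Y), 2^-1 *: (Y * E - E * Y)).
  move=> Tv /=; have [YA _ _] := operator_of_tangent Tv.
  have [-> _] := orbit_differential uu pPQ0 Tv ge.
  by have [-> ->] := commutator_root YA.
split.
- apply: closed_linearI => //.
  have -> : [set v | 'd g u v = 0] = [set v | fderiv g u v = 0].
    by rewrite fderivE.
  exact: clin_kernel_closed_linear.
- by move=> v [].
exists (T `&` [set v | anti v = 0]); split.
- by apply: closed_linearI => //; exact: clin_kernel_closed_linear.
- by move=> v [].
- apply/seteqP; split=> [v [[Tv dv] [_ /= av]]|v ->]; last first.
    have T0 : T 0 by case: Tcl.
    by split; split => //=; [rewrite -(fderivE dg) clin0|rewrite mul0r mul0r mulr0 addr0].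
  have [YA Ya vE] := operator_of_tangent Tv.
  set Y := csub_val v * adj U in av vE.
  have {}dv : 2^-1 *: (Y * E - E * Y) = 0 := congr1 fst (etrans (esym (dgE _ Tv)) dv).
  apply: val_inj => /=; rewrite vE.
  suff -> : Y = 0 by rewrite mul0r.
  have YE : Y * E = 0.
    apply: bphi_ext => x y; have := congr1 (bphi x y) av.
    by have := congr1 (bphi x y) dv; rewrite !(bphiD, bphiN, bphiZ, bphi0); lra.
  by rewrite -[Y]mulr1 -(mulrbV iE) mulrA YE mul0r.
move=> v Tv; have [YA Ya vE] := operator_of_tangent Tv.
set Y := csub_val v * adj U in YA Ya vE; clearbody Y; have [Ea EA EE] := rE.
have EV := mulrbV iE; have VE := mulVrb iE.
have CY : E * E * Y = Y * (E * E).
  by rewrite EE mulrBl mulrBr mul1r mulr1 -mulrA -YA mulrA -YA mulrA.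
(* [E] need not be unitary: that [Y'] is anti-Hermitian rests on [CY], by which conjugation by [E]
   and by its inverse agree on [Y]. The half sum and half difference of [Y] and [Y'] are the two
   components. *)
pose Y' := E * Y * binv E.
have EY' : E * Y' = Y * E.
  by rewrite /Y' !mulrA CY -!mulrA EV mulr1.
have YE' : Y' * E = E * Y by rewrite /Y' -mulrA VE mulr1.
have Y'a : adj Y' = - Y'.
  rewrite /Y' !adjM adj_binv// Ea Ya mulNr mulrN; congr (- _).
  by rewrite -[Y * E]mulr1 -EV -!mulrA (mulrA E E) (mulrA Y) -CY !mulrA VE mul1r.
have Y'A : Y' * A = A * Y'.
  rewrite /Y' -(mulrA (E * Y)) binv_root_anticommute mulrN (mulrA (E * Y)).
  by rewrite -(mulrA E Y A) YA (mulrA E A) EA !mulNr opprK !mulrA.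
have [||w Tw wE] := @tangent_of_operator (2^-1 *: (Y + Y')).
- by rewrite bop_scalerAl bop_scalerAr mulrDl mulrDr YA Y'A.
- by rewrite adjZ adjD Ya Y'a -opprD scalerN.
have [||w' Tw' wE'] := @tangent_of_operator (2^-1 *: (Y - Y')).
- by rewrite bop_scalerAl bop_scalerAr mulrBl mulrBr YA Y'A.
- by rewrite adjZ adjB Ya Y'a; bop_abel.
have wY : csub_val w * adj U = 2^-1 *: (Y + Y') by rewrite wE -mulrA U1 mulr1.
have wY' : csub_val w' * adj U = 2^-1 *: (Y - Y') by rewrite wE' -mulrA U1 mulr1.
exists w.
  split => //=; rewrite (dgE _ Tw) wY.
  rewrite bop_scalerAl bop_scalerAr (mulrDl Y Y' E) (mulrDr E Y Y') YE' EY'.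
  by congr (_, _); bop_abel.
exists w'.
  split => //=; rewrite wY' bop_scalerAl bop_scalerAr (mulrBl E Y Y') (mulrBr E Y Y') YE' EY'.
  by bop_abel.
apply: val_inj => /=; rewrite vE wE wE' -mulrDl; congr (_ * _).
by bop_abel.
Qed.

End OrbitPoint.

Lemma orbit_submersion P Q : projection_pairs A (P, Q) ->
  submersion (commutant_unitary A) (projection_pairs A) (unitary_orbit P Q).
Proof.
move=> pPQ; split=> [u|u uu|u g uu ge]; first exact: orbit_pairs.
  (* The orbit formula uses the adjoint instead of the inverse, so it is its own smooth extension to
     the whole commutant. *)
  exists (unitary_orbit P Q), setT; split => //; first exact: openT.
  by apply: orbit_smooth_curve; [exact: openT|move=> n; apply: Cn_id; exact: openT].
split; [exact: orbit_differential_surjective|exact: (orbit_kernel_complemented pPQ uu)].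
Qed.

End OrbitSubmersion.

(** * Closed range and invertibility on the generic space *)

Section GenericPart.
Context {R : realType} {H : hilbertType R} (A : bop H).
Hypothesis DA : projection_difference A.
Hypothesis closed_range : closed (range (bop_fun (A ^+ 2 - 1))).
Let A0 := generic_part DA.
Let G := generic_space A.
Let B := A ^+ 2 - 1.

Let A_sym x y : inner (A x) y = inner x (A y).
Proof.
have [P [Q [/orthogonal_projection_sym Ps /orthogonal_projection_sym Qs ->]]] := DA.
by rewrite !bop_subE innerBl innerBr Ps Qs.
Qed.

Let BE x : B x = A (A x) - x.
Proof. by rewrite /B bop_subE expr2. Qed.

Let B_sym x y : inner (B x) y = inner x (B y).
Proof. by rewrite !BE innerBl innerBr !A_sym. Qed.

Let B_invariant x : csub_set G x -> csub_set G (B x).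
Proof.
move=> Gx; rewrite BE -scaleN1r addrC.
have [_ GL _] := csub_closed_linear G.
by apply: GL => //; exact: generic_space_invariant DA _ (generic_space_invariant DA Gx).
Qed.

Let kernel_orthogonal x z : csub_set G x -> B z = 0 -> inner z x = 0.
Proof.
move=> Gx Bz; apply: Gx; exists 0, z; split => //; last by rewrite add0r.
exact: bop0.
Qed.

Let generic_range y : csub_set G y -> exists2 x, csub_set G x & B x = y.
Proof.
move=> Gy.
have rl : closed_linear (range B).
  split=> //; first by exists 0; rewrite // bop0.
  by move=> a _ _ [u _ <-] [v _ <-]; exists (a *: u + v) => //; rewrite bop_linear.
have [z [x _ xz] zP] := orthogonal_decomposition (CSubspace rl) y.
(* [y - z] is orthogonal to the range, hence in the kernel by symmetry; it is then orthogonal both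
   to [y], which lies in [G], and to [z], so it vanishes. *)
have Byz : B (y - z) = 0.
  apply: inner_injr => w; rewrite inner0r -B_sym; apply: zP.
  by exists w.
have yz : y = z.
  apply/eqP; rewrite -subr_eq0 -normr_eq0 -sqrf_eq0 -inner_norm innerBr.
  have zz : inner (y - z) z = 0 by rewrite -{2}xz -B_sym Byz inner0l.
  by rewrite (kernel_orthogonal Gy)// zz subrr.
(* The preimage may leave [G]; its projection works too, since [y - B x2] lies in [G] and equals
   [B (x - x2)], which is orthogonal to [G]. *)
have [x2 Gx2 x2P] := orthogonal_decomposition G x; exists x2 => //.
have GBx : csub_set G (y - B x2).
  have [_ GL _] := csub_closed_linear G; rewrite -scaleN1r addrC.
  by apply: GL => //; exact: B_invariant.
have yB : y - B x2 = B (x - x2) by rewrite bopB xz yz.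
apply/esym/eqP; rewrite -subr_eq0 -normr_eq0 -sqrf_eq0 -inner_norm.
by rewrite {2}yB -B_sym x2P//; exact: B_invariant.
Qed.

(** All that later arguments retain of the closed range hypothesis. *)
Lemma generic_part_invertible : invertible (1 - A0 * A0).
Proof.
have TE (x : csub G) : csub_val ((1 - A0 * A0) x) = - B (csub_val x).
  by rewrite bop_subE BE opprB.
apply: symmetric_bijective_invertible.
- move=> x y; have IE (u v : csub G) : inner u v = inner (csub_val u) (csub_val v) by [].
  rewrite !IE !TE -[- B (csub_val x)]sub0r -[- B (csub_val y)]sub0r.
  by rewrite innerBl innerBr inner0l inner0r B_sym.
- move=> x /(congr1 (@csub_val _ _ _)); rewrite TE => /eqP; rewrite oppr_eq0 => /eqP Bx.
  apply: val_inj => /=; apply/eqP; rewrite -normr_eq0 -sqrf_eq0 -inner_norm.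
  by rewrite (kernel_orthogonal (csub_in x) Bx).
move=> y; have [x Gx Bx] := generic_range (csub_in (- y)).
exists (CSub (introT (asboolP _) Gx)); apply: val_inj.
by rewrite [LHS]TE; apply/eqP; rewrite eqr_oppLR; apply/eqP; exact: Bx.
Qed.

End GenericPart.

Theorem proposition6p6 (R : realType) (H : hilbertType R) (A : bop H)
    (DA : projection_difference A)
    (closed_range : closed (range (bop_fun (A ^+ 2 - 1)))) :
  let A0 := generic_part DA in
  complemented_submanifold (projection_pairs A0) /\
  forall P0 Q0 : bop (csub (generic_space A)),
    projection_pairs A0 (P0, Q0) ->
    submersion (commutant_unitary A0) (projection_pairs A0)
      (unitary_orbit P0 Q0).
Proof.
move=> A0; have iC : invertible (1 - A0 * A0) by exact: generic_part_invertible.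
split; first exact: pairs_submanifold.
by move=> P0 Q0; exact: orbit_submersion.
Qed.
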